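(* Let $p(\cdot):\mathbb{N}\to[1,\infty)$ be an exponent function. Then the dual space $(\ell^{p(\cdot)})^*$ is isomorphic to the external direct sum $$\ell^{p'(\cdot)}\oplus pba_\omega(\mathcal{M}_{p(\cdot)})\oplus\left(\ell^{p(\cdot)}/\overline{S_{p(\cdot)}}\right)^*.$$
   Context: Sequences are real. For $q(\cdot):\mathbb{N}\to[1,\infty]$, with $N_\infty=\{k:q(k)=\infty\}$, the modular is $\rho_{q(\cdot)}(x)=\sum_{k\notin N_\infty}|x(k)|^{q(k)}+\sup_{k\in N_\infty}|x(k)|$, and $\ell^{q(\cdot)}$ is the Banach space of sequences $x$ with $\rho_{q(\cdot)}(x/\lambda)<\infty$ for some $\lambda>0$, normed by $\|x\|_{\ell^{q(\cdot)}}=\inf\{\lambda>0:\rho_{q(\cdot)}(x/\lambda)\le1\}$. The dual exponent is given by $1/p(k)+1/p'(k)=1$, with $1/\infty=0$. Let $\ell^{p(\cdot)}_b$ be the set of $x\in\ell^{p(\cdot)}$ with $p$ bounded on $\operatorname{supp}(x)=\{k:x(k)\neq0\}$, and let $\ell^{p(\cdot)}_{\mathrm{germ}}=\ell^{p(\cdot)}/\overline{\ell^{p(\cdot)}_b}$ with the quotient norm; $[x]$ is the class of $x$. A set $A\subseteq\mathbb{N}$ has finite $p(\cdot)$-content if there is $B>1$ with $\sum_{k\in A}B^{-p(k)}<\infty$; $\mathcal{M}_{p(\cdot)}$ is the collection of all such sets. For $A\in\mathcal{M}_{p(\cdot)}$ put $\omega(A)=\|[\mathbf 1_A]\|_{\ell^{p(\cdot)}_{\mathrm{germ}}}$.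 Let $S_{p(\cdot)}$ be the set of all finite sums $\sum_{k=1}^N\alpha_k\mathbf 1_{A_k}$ with $\alpha_k\in\mathbb{R}$ and $A_k\in\mathcal{M}_{p(\cdot)}$ pairwise disjoint; $\overline{S_{p(\cdot)}}$ is its closure in $\ell^{p(\cdot)}$. $pba_\omega(\mathcal{M}_{p(\cdot)})$ is the vector space of set functions $\mu:\mathcal{M}_{p(\cdot)}\to\mathbb{R}$ such that (1) $\mu(A\cup B)=\mu(A)+\mu(B)$ for all disjoint $A,B\in\mathcal{M}_{p(\cdot)}$, and (2) there is $C>0$ such that $\sum_{i=1}^n\frac{|\mu(A_i)|}{\omega(A_i)}\le C$ for every finite collection of pairwise disjoint $A_1,\dots,A_n\in\mathcal{M}_{p(\cdot)}$, with the conventions $0/0=0$ and $c/0=\infty$ for $c>0$ (so $\mu(A)=0$ whenever $\omega(A)=0$, in particular for finite $A$). Its norm is the infimum of the $C>0$ for which (2) holds. ''Isomorphic'' means there is a bounded linear bijection with bounded inverse. *)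

(* Defs.v *)
From HB Require Import structures.
From mathcomp Require Import all_boot all_order all_algebra.
From mathcomp Require Import all_classical all_reals all_analysis.
From mathcomp Require Import generic_quotient ring_quotient.
From mathcomp Require Import ring.

Set Implicit Arguments.
Unset Strict Implicit.
Unset Printing Implicit Defensive.

Import Order.TTheory GRing.Theory Num.Theory.
Import numFieldNormedType.Exports.

Local Open Scope classical_set_scope.
Local Open Scope ring_scope.
Local Open Scope quotient_scope.

Section bounded_operators.
Context {R : realType}.

Definition bounded_operator (E F : normedModType R) (f : E -> F) :=
  exists C : R, forall x, `|f x| <= C * `|x|.

Definition isomorphic (E F : normedModType R) :=
  exists (f : {linear E -> F}) (g : {linear F -> E}),
    [/\ cancel f g, cancel g f, bounded_operator f & bounded_operator g].

End bounded_operators.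

Section dual_space.
Context {R : realType} (E : normedModType R).

Definition functional : {pred E -> R} :=
  fun f => `[< linear f /\ bounded_operator f >].

Lemma functional_submod_closed : submod_closed functional.
Proof.
split.
  apply/asboolP; split; first by move=> a x y /=; rewrite scaler0 addr0.
  by exists 0 => x; rewrite normr0 mul0r.
move=> a f g /asboolP[lf [C fC]] /asboolP[lg [D gD]]; apply/asboolP; split.
  move=> b x y; rewrite !fctE lf lg /GRing.scale/=; ring.
exists (`|a| * C + D) => x; rewrite fctE mulrDl.
rewrite (le_trans (ler_normD _ _))// lerD//.
by rewrite normrZ -mulrA ler_wpM2l.
Qed.

HB.instance Definition _ :=
  GRing.isSubmodClosed.Build R (E -> R) functional functional_submod_closed.

Record dual := Dual { dual_fun :> E -> R ; dual_funP : dual_fun \in functional }.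

HB.instance Definition _ := [isSub for dual_fun].
HB.instance Definition _ := [Choice of dual by <:].
HB.instance Definition _ := [SubChoice_isSubLmodule of dual by <:].

Definition dual_norm (f : dual) : R :=
  sup [set `|f x| | x in [set x : E | `|x| <= 1]].


Implicit Types f g : dual.

Lemma dual_lin f : linear f.
Proof. by have /asboolP[] := dual_funP f. Qed.

Lemma dualZ f a x : f (a *: x) = a * f x.
Proof.
have f0 : f 0 = 0.
  have := dual_lin f (-1) 0 0.
  by rewrite scaler0 addr0 [_ *: _]mulN1r addNr.
by have := dual_lin f a x 0; rewrite !addr0 f0 addr0.
Qed.

Let vals f := [set `|f x| | x in [set x : E | `|x| <= 1]].

Let has_sup_vals f : has_sup (vals f).
Proof.
split; first by exists `|f 0|; exists 0 => //=; rewrite normr0.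
have /asboolP[_ [C fC]] := dual_funP f.
exists `|C| => _ [x /= x1 <-]; rewrite (le_trans (fC x))//.
rewrite (le_trans (ler_norm _))// normrM normr_id.
by rewrite ler_piMr.
Qed.

Let vals_le f x : `|x| <= 1 -> `|f x| <= dual_norm f.
Proof. by move=> x1; apply: ub_le_sup; [case: (has_sup_vals f)|exists x]. Qed.

Lemma dual_norm_ub f x : `|f x| <= dual_norm f * `|x|.
Proof.
have [->|x0] := eqVneq x 0.
  by rewrite -(scale0r (0 : E)) dualZ mul0r scale0r !normr0 mulr0.
have nx : 0 < `|x| by rewrite normr_gt0.
have /= := @vals_le f (`|x|^-1 *: x).
rewrite normrZ dualZ normrM normfV normr_id mulVf ?gt_eqF// => /(_ (lexx _)).
by rewrite mulrC ler_pdivrMr.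
Qed.

Lemma dual_norm_le f C :
  (forall x, `|x| <= 1 -> `|f x| <= C) -> dual_norm f <= C.
Proof.
move=> fC; apply: ge_sup; first by case: (has_sup_vals f).
by move=> _ [x /= x1 <-]; exact: fC.
Qed.

Lemma dual_norm_ge0 f : 0 <= dual_norm f.
Proof. by rewrite (le_trans (normr_ge0 (f 0)))// vals_le// normr0. Qed.

Lemma dual_normD f g : dual_norm (f + g) <= dual_norm f + dual_norm g.
Proof.
apply: dual_norm_le => x x1; rewrite (le_trans (ler_normD _ _))//.
by rewrite lerD// vals_le.
Qed.

Lemma dual_normZ a f : dual_norm (a *: f) = `|a| * dual_norm f.
Proof.
have le b g : dual_norm (b *: g) <= `|b| * dual_norm g.
  apply: dual_norm_le => x x1; rewrite normrM ler_wpM2l//; exact: vals_le.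
apply/eqP; rewrite eq_le le/=.
have [->|a0] := eqVneq a 0; first by rewrite normr0 mul0r dual_norm_ge0.
have := le a^-1 (a *: f); rewrite scalerA mulVf// scale1r normfV.
by rewrite ler_pdivlMl// normr_gt0.
Qed.

Lemma dual_norm_eq0 f : dual_norm f = 0 -> f = 0.
Proof.
move=> f0; apply/val_inj/funext => x /=; apply/normr0_eq0/eqP.
by rewrite eq_le normr_ge0 andbT (le_trans (dual_norm_ub f x))// f0 mul0r.
Qed.

HB.instance Definition _ :=
  Lmodule_isNormed.Build R dual dual_normD dual_normZ dual_norm_eq0.

End dual_space.

Section quotient_space.
Context {R : realType} (E : normedModType R) (S : submodClosed E).

Definition closurep : {pred E} := fun x => `[< closure [set` S] x >].

Lemma closurepP x :
  reflect (forall e, 0 < e -> exists2 y, y \in S & `|x - y| < e)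
          (x \in closurep).
Proof.
apply: (iffP (asboolP _)) => [clx e e0|clx B].
  have /clx[y [/= Sy]] := nbhsx_ballx x e e0.
  by rewrite -ball_normE /= => xy; exists y.
move=> /nbhs_ballP[e /= e0 xB]; have [y Sy xy] := clx e e0.
by exists y; split => //; apply: xB; rewrite -ball_normE.
Qed.

Lemma closurep_submod_closed : submod_closed closurep.
Proof.
split.
  by apply/closurepP => e e0; exists 0; rewrite ?rpred0// subr0 normr0.
move=> a x y /closurepP clx /closurepP cly; apply/closurepP => e e0.
have e2 : 0 < e / 2 by rewrite divr_gt0.
have a0 : 0 < `|a| + 1 by rewrite ltr_wpDl.
have [x' Sx' xx'] := clx (e / 2 / (`|a| + 1)) (divr_gt0 e2 a0).
have [y' Sy' yy'] := cly _ e2.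
exists (a *: x' + y'); first by rewrite rpredD// rpredZ.
rewrite opprD addrACA -scalerBr (le_lt_trans (ler_normD _ _))//.
rewrite [ltRHS]splitr ltrD// normrZ.
move: xx'; rewrite ltr_pdivlMr// => /le_lt_trans; apply.
by rewrite mulrC ler_wpM2l// lerDl.
Qed.

HB.instance Definition _ :=
  GRing.isSubmodClosed.Build R E closurep closurep_submod_closed.

Definition quot_closure := Quotient.quot closurep.

HB.instance Definition _ := GRing.Zmodule.on quot_closure.
HB.instance Definition _ := EqQuotient.on quot_closure.

Local Notation Q := quot_closure.
Local Notation pi := (\pi_(Q) : E -> Q).

Lemma quot_piP x y : reflect (pi x = pi y) (x - y \in closurep).
Proof. by rewrite Quotient.idealrBE; apply: eqP. Qed.

Definition quot_scale (a : R) (x : Q) : Q := pi (a *: repr x).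

Lemma quot_pi_scale a x : quot_scale a (pi x) = pi (a *: x).
Proof.
by apply/quot_piP; rewrite -scalerBr rpredZ//; apply/quot_piP; rewrite reprK.
Qed.

Lemma quot_piD x y : pi (x + y) = pi x + pi y.
Proof. by rewrite Quotient.pi_add. Qed.

Lemma quot_piN x : pi (- x) = - pi x.
Proof. by rewrite Quotient.pi_opp. Qed.

Lemma quot_scaleA a b v : quot_scale a (quot_scale b v) = quot_scale (a * b) v.
Proof. by rewrite -[v]reprK (quot_pi_scale b) !quot_pi_scale scalerA. Qed.

Lemma quot_scale1 : left_id 1 quot_scale.
Proof. by move=> v; rewrite -[v]reprK quot_pi_scale scale1r. Qed.

Lemma quot_scaleDr : right_distributive quot_scale +%R.
Proof.
move=> a u v; rewrite -[u]reprK -[v]reprK -quot_piD !quot_pi_scale.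
by rewrite -quot_piD scalerDr.
Qed.

Lemma quot_scaleDl v : {morph quot_scale^~ v : a b / a + b}.
Proof.
by move=> a b; rewrite -[v]reprK !quot_pi_scale -quot_piD scalerDl.
Qed.

HB.instance Definition _ := GRing.Zmodule_isLmodule.Build R Q
  quot_scaleA quot_scale1 quot_scaleDr quot_scaleDl.

Definition quot_norm (v : Q) : R := inf [set `|x| | x in [set x | pi x = v]].

Let has_lbound_quot v : has_lbound [set `|x| | x in [set x | pi x = v]].
Proof. by exists 0 => _ [x _ <-]. Qed.

Lemma quot_norm_le x : quot_norm (pi x) <= `|x|.
Proof. by apply: ge_inf => //; exists x. Qed.

Lemma quot_norm_lt v e : quot_norm v < e -> exists2 x, pi x = v & `|x| < e.
Proof.
have hi : has_inf [set `|x| | x in [set x | pi x = v]].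
  by split => //; exists `|repr v|, (repr v) => //=; rewrite reprK.
rewrite -subr_gt0 => ve; have [_ [x /= xv <-]] := inf_adherent ve hi.
by rewrite addrC subrK => xe; exists x.
Qed.

Lemma quot_norm_ge0 v : 0 <= quot_norm v.
Proof.
apply: lb_le_inf; first by exists `|repr v|, (repr v) => //=; rewrite reprK.
by move=> _ [x _ <-].
Qed.

Lemma quot_normD u v : quot_norm (u + v) <= quot_norm u + quot_norm v.
Proof.
apply/ler_addgt0Pr => e e0; have e2 : 0 < e / 2 by rewrite divr_gt0.
have [x <- xe] : exists2 x, pi x = u & `|x| < quot_norm u + e / 2.
  by apply: quot_norm_lt; rewrite ltrDl.
have [y <- ye] : exists2 y, pi y = v & `|y| < quot_norm v + e / 2.
  by apply: quot_norm_lt; rewrite ltrDl.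
rewrite -quot_piD (le_trans (quot_norm_le _))// (le_trans (ler_normD _ _))//.
rewrite (le_trans (ltW (ltrD xe ye)))//.
by rewrite [in leRHS](splitr e) addrACA.
Qed.

Lemma quot_normZ a v : quot_norm (a *: v) = `|a| * quot_norm v.
Proof.
have le b u : quot_norm (b *: u) <= `|b| * quot_norm u.
  apply/ler_addgt0Pr => e e0; have b0 : 0 < `|b| + 1 by rewrite ltr_wpDl.
  have [x <- xe] : exists2 x, pi x = u & `|x| < quot_norm u + e / (`|b| + 1).
    by apply: quot_norm_lt; rewrite ltrDl divr_gt0.
  rewrite [_ *: _]quot_pi_scale (le_trans (quot_norm_le _))// normrZ.
  rewrite (le_trans (ler_wpM2l _ (ltW xe)))// mulrDr lerD2l.
  by rewrite mulrCA ler_piMr ?(ltW e0)// ler_pdivrMr// mul1r lerDl.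
apply/eqP; rewrite eq_le le/=.
have [->|a0] := eqVneq a 0; first by rewrite normr0 mul0r quot_norm_ge0.
have := le a^-1 (a *: v); rewrite scalerA mulVf// scale1r normfV.
by rewrite ler_pdivlMl// normr_gt0.
Qed.

Lemma quot_norm_eq0 v : quot_norm v = 0 -> v = 0.
Proof.
move=> v0; rewrite -[v]reprK -[RHS]reprK; apply/quot_piP/closurepP => e e0.
have e2 : 0 < e / 2 by rewrite divr_gt0.
have [x xv xe] : exists2 x, pi x = v & `|x| < e / 2.
  by apply: quot_norm_lt; rewrite v0.
have : repr v - repr (0 : Q) - x \in closurep.
  apply/quot_piP; rewrite xv quot_piD reprK -[in RHS](addr0 v); congr +%R.
  by rewrite quot_piN reprK oppr0.
move=> /closurepP/(_ _ e2)[y Sy ye]; exists y => //.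
rewrite [ltRHS]splitr -(subrK x (_ - y)) (le_lt_trans (ler_normD _ _))//.
by rewrite ltrD// addrAC.
Qed.

HB.instance Definition _ :=
  Lmodule_isNormed.Build R Q quot_normD quot_normZ quot_norm_eq0.

End quotient_space.

Record exponent (R : realType) := Exponent {
  expo : nat -> \bar R ;
  expo_ge1 : forall k, (1 <= expo k)%E }.

Record finite_exponent (R : realType) := FiniteExponent {
  fexpo :> nat -> R ;
  fexpo_ge1 : forall k, 1 <= fexpo k }.

Section exponents.
Context {R : realType}.

Lemma fexpo_EFin_ge1 (p : finite_exponent R) k : (1 <= (p k)%:E)%E.
Proof. by rewrite lee_fin fexpo_ge1. Qed.

Definition fin_exponent (p : finite_exponent R) : exponent R :=
  Exponent (fexpo_EFin_ge1 p).

Lemma hoelder_conjugate_ge1 (r : \bar R) :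
  (1 <= r -> 1 <= hoelder_conjugate r)%E.
Proof.
case: r => [r| |]//; rewrite ?hoelder_conjugatey// lee_fin => r1.
have [->|nr1] := eqVneq r 1; first by rewrite hoelder_conjugate1 leey.
have r0 : 0 < r - 1 by rewrite subr_gt0 lt_neqAle eq_sym nr1.
rewrite /hoelder_conjugate/= eqe gt_eqF ?(lt_le_trans ltr01)//.
rewrite -EFinB inver gt_eqF// -EFinM lee_fin ler_pdivlMr// mul1r.
by rewrite lerBlDr lerDl.
Qed.

Definition dual_exponent (q : exponent R) : exponent R :=
  Exponent (fun k => hoelder_conjugate_ge1 (expo_ge1 q k)).

Lemma dual_exponentP (q : exponent R) k :
  ((expo q k)^-1 + (expo (dual_exponent q) k)^-1 = 1)%E.
Proof.
have q1 := expo_ge1 q k; apply: hoelder_conjugate_eq1.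
  by rewrite (lt_le_trans _ q1)// ltNyr.
by rewrite gt_eqF// (lt_le_trans _ q1)// lte01.
Qed.

End exponents.

Coercion fin_exponent : finite_exponent >-> exponent.

Section variable_lebesgue.
Context {R : realType} (q : exponent R).
Implicit Types (x y : nat -> R) (a b l m : R).

(* The supremum is taken over nonnegative reals: 0 is adjoined so that it is 0
   rather than -oo when q has no infinite value. *)
Definition modular x : \bar R :=
  (\esum_(k in [set k | expo q k != +oo]) (`|x k| `^ fine (expo q k))%:E +
   ereal_sup (0 |` [set `|x k|%:E | k in [set k | expo q k = +oo]]))%E.

Let term x k : (0 <= (`|x k| `^ fine (expo q k))%:E)%E.
Proof. by rewrite lee_fin powR_ge0. Qed.

Let fexp_ge1 k : expo q k != +oo%E -> 1 <= fine (expo q k).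
Proof.
by have := expo_ge1 q k; case: (expo q k) => //= r; rewrite lee_fin.
Qed.

Let sup_ge0 x :
  (0 <= ereal_sup (0 |` [set `|x k|%:E | k in [set k | expo q k = +oo]]))%E.
Proof. by apply: ereal_sup_ubound; left. Qed.

Lemma modular_ge0 x : (0 <= modular x)%E.
Proof. by rewrite adde_ge0// esum_ge0. Qed.

Lemma modular_le x y :
  (forall k, `|x k| <= `|y k|) -> (modular x <= modular y)%E.
Proof.
move=> xy; apply: leeD.
  apply: le_esum => k /fexp_ge1 q1; rewrite lee_fin ge0_ler_powR ?nnegrE//.
  by rewrite (le_trans ler01).
apply: ge_ereal_sup => _ [->|[k qk <-]]; first exact: sup_ge0.
apply: (@le_trans _ _ `|y k|%:E); first by rewrite lee_fin.
by apply: ereal_sup_ubound; right; exists k.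
Qed.

Lemma modular_convex a b x y : 0 <= a -> 0 <= b -> a + b = 1 ->
  (modular (fun k => a * x k + b * y k)%R <=
   a%:E * modular x + b%:E * modular y)%E.
Proof.
move=> a0 b0 ab.
have esumZ c (f : nat -> \bar R) (D : set nat) : 0 <= c ->
    (forall k, 0 <= f k)%E ->
    (\esum_(k in D) (c%:E * f k) <= c%:E * \esum_(k in D) f k)%E.
  move=> c0 f0; apply: ge_ereal_sup => _ [F [finF FD] <-].
  rewrite -ge0_mule_fsumr// lee_wpmul2l ?lee_fin//.
  by apply: ereal_sup_ubound; exists F.
rewrite /modular !ge0_muleDr ?esum_ge0//.
rewrite addeACA; apply: leeD.
  apply: (@le_trans _ _ (\esum_(k in [set k | expo q k != +oo]%E)
     (a%:E * (`|x k| `^ fine (expo q k))%:E +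
      b%:E * (`|y k| `^ fine (expo q k))%:E))%E).
    apply: le_esum => k /fexp_ge1 q1.
    have t1 : a <= 1 by rewrite -ab lerDl.
    have := @convex_powR R _ q1 (Itv01 a0 t1) `|x k| `|y k|.
    rewrite !inE/= !in_itv/= !andbT !normr_ge0 => /(_ isT isT).
    rewrite !convRE/= => cvx.
    have {}cvx : (a * `|x k| + (1 - a) * `|y k|) `^ fine (expo q k) <=
      a * `|x k| `^ fine (expo q k) + (1 - a) * `|y k| `^ fine (expo q k) := cvx.
    have bE : 1 - a = b by rewrite -ab addrAC subrr add0r.
    rewrite bE in cvx.
    rewrite -!EFinM -EFinD lee_fin (le_trans _ cvx)//.
    rewrite ge0_ler_powR ?nnegrE ?addr_ge0 ?mulr_ge0//.
      by rewrite (le_trans ler01).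
    by rewrite (le_trans (ler_normD _ _))// !normrM (ger0_norm a0) (ger0_norm b0).
  rewrite esumD; last 2 first.
    by move=> k _; rewrite mule_ge0 ?lee_fin ?powR_ge0.
    by move=> k _; rewrite mule_ge0 ?lee_fin ?powR_ge0.
  by apply: leeD; apply: esumZ => // k.
apply: ge_ereal_sup => _ [->|[k qk <-]].
  by rewrite adde_ge0// mule_ge0.
rewrite (@le_trans _ _ (a%:E * `|x k|%:E + b%:E * `|y k|%:E)%E)//.
  rewrite -!EFinM -EFinD lee_fin (le_trans (ler_normD _ _))//.
  by rewrite !normrM (ger0_norm a0) (ger0_norm b0).
by apply: leeD; rewrite lee_wpmul2l ?lee_fin//; apply: ereal_sup_ubound; right; exists k.
Qed.

Lemma modular_scale a x : 0 <= a <= 1 ->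
  (modular (fun k => a * x k)%R <= a%:E * modular x)%E.
Proof.
move=> /andP[a0 a1].
have := @modular_convex a (1 - a) x (fun=> 0) a0.
rewrite subr_ge0 a1 addrC subrK => /(_ isT erefl).
have -> : modular (fun=> 0) = 0%E.
  rewrite /modular esum1 ?add0e; last first.
    move=> k /fexp_ge1 q1; rewrite normr0 powR0// gt_eqF//.
    by rewrite (lt_le_trans ltr01).
  apply/eqP; rewrite eq_le sup_ge0 andbT.
  by apply: ge_ereal_sup => _ [->|[k _ <-]]//; rewrite normr0.
rewrite mule0 adde0; congr (modular _ <= _)%E.
by apply/funext => k; rewrite mulr0 addr0.
Qed.

Lemma modular_le1 x k : (modular x <= 1)%E -> `|x k| <= 1.
Proof.
move=> x1; have [qk|qk] := eqVneq (expo q k) +oo%E.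
  rewrite -lee_fin (le_trans _ x1)// /modular.
  rewrite -[leLHS]add0e leeD ?esum_ge0//.
  by apply: ereal_sup_ubound; right; exists k.
have q1 := fexp_ge1 qk; have q0 : 0 < fine (expo q k).
  by rewrite (lt_le_trans ltr01).
have : ((`|x k| `^ fine (expo q k))%:E <= 1)%E.
  rewrite (le_trans _ x1)// /modular -[leLHS]adde0 leeD//.
  apply: esum_ge; exists [set k]; last by rewrite fsbig_set1.
  by split; [exact: finite_set1|move=> _ ->].
rewrite lee_fin => xk; rewrite leNgt; apply/negP => x1'.
move: xk; rewrite leNgt => /negP; apply.
have <- : 1 `^ fine (expo q k) = 1 :> R by rewrite powR1.
by rewrite gt0_ltr_powR ?nnegrE.
Qed.

Definition ellp : {pred nat -> R} :=
  fun x => `[< exists2 l, 0 < l & (modular (fun k => x k / l)%R < +oo)%E >].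

Let conv_comb l m x y : 0 < l -> 0 < m ->
  (modular (fun k => (x k + y k) / (l + m))%R <=
   (l / (l + m))%:E * modular (fun k => x k / l)%R +
   (m / (l + m))%:E * modular (fun k => y k / m)%R)%E.
Proof.
move=> l0 m0; have lm : 0 < l + m by rewrite addr_gt0.
rewrite [X in modular X](_ : _ = fun k =>
    l / (l + m) * (x k / l) + m / (l + m) * (y k / m)).
  apply: modular_convex; rewrite ?divr_ge0 ?ltW//.
  by rewrite -mulrDl divff// gt_eqF.
by apply/funext => k; field; rewrite !gt_eqF.
Qed.

Let scaleE l a x : a != 0 ->
  modular (fun k => a * x k / (`|a| * l)) = modular (fun k => x k / l).
Proof.
move=> a0; apply/eqP; rewrite eq_le; apply/andP; split; apply: modular_le => k;
  by rewrite !normrM !normfV normrM normr_id invfM mulrACA divff ?mul1r// normr_eq0.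
Qed.

Lemma ellp_submod_closed : submod_closed ellp.
Proof.
have add x y : x \in ellp -> y \in ellp -> x + y \in ellp.
  move=> /asboolP[l l0 lx] /asboolP[m m0 my]; apply/asboolP.
  exists (l + m); first by rewrite addr_gt0.
  rewrite (le_lt_trans (conv_comb _ _ l0 m0))//.
  by rewrite lte_add_pinfty// lte_mul_pinfty// ?lee_fin ?divr_ge0 ?addr_ge0 ?ltW.
have zero : 0 \in ellp.
  apply/asboolP; exists 1 => //.
  rewrite [X in modular X](_ : _ = fun k => 0 * 0).
    rewrite (le_lt_trans (@modular_scale 0 (fun=> 0) _)) ?lexx ?ler01//.
    by rewrite mul0e.
  by apply/funext => k; rewrite !mul0r.
split=> // a x y xq yq; apply: add => //.
have [->|a0] := eqVneq a 0; first by rewrite scale0r.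
move: xq => /asboolP[l l0 lx]; apply/asboolP; exists (`|a| * l).
  by rewrite mulr_gt0// normr_gt0.
by rewrite scaleE.
Qed.

HB.instance Definition _ :=
  GRing.isSubmodClosed.Build R (nat -> R) ellp ellp_submod_closed.

Record ell := Ell { ell_seq :> nat -> R ; ell_seqP : ell_seq \in ellp }.

HB.instance Definition _ := [isSub for ell_seq].
HB.instance Definition _ := [Choice of ell by <:].
HB.instance Definition _ := [SubChoice_isSubLmodule of ell by <:].

Definition ell_norm (x : ell) : R :=
  inf [set l | 0 < l /\ (modular (fun k => x k / l)%R <= 1)%E].

Implicit Types u v : ell.

Let adm u := [set l | 0 < l /\ (modular (fun k => u k / l)%R <= 1)%E].

Let adm_nonempty u : adm u !=set0.
Proof.
have /asboolP[l l0] := ell_seqP u; set M := modular _ => Moo.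
have M0 : (0 <= M)%E by exact: modular_ge0.
have f0 : 0 <= fine M by exact: fine_ge0.
have Mf : M = (fine M)%:E by rewrite fineK// ge0_fin_numE.
have s0 : 0 < 1 + fine M by rewrite ltr_pwDl.
exists (l * (1 + fine M)); split; first by rewrite mulr_gt0.
have := @modular_scale (1 + fine M)^-1 (fun k => u k / l) _.
rewrite -/M => h; rewrite [X in modular X](_ : _ = fun k =>
    (1 + fine M)^-1 * (u k / l)); last first.
  by apply/funext => k; rewrite invfM mulrA mulrC.
rewrite (le_trans (h _))//.
  by rewrite invr_ge0 ltW//= invf_le1// lerDl.
by rewrite Mf -EFinM lee_fin mulrC ler_pdivrMr// mul1r lerDr.
Qed.

Let adm_lb u : has_lbound (adm u).
Proof. by exists 0 => l [/ltW]. Qed.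

Lemma ell_norm_ge0 u : 0 <= ell_norm u.
Proof.
apply: lb_le_inf; first exact: adm_nonempty.
by move=> l [/ltW].
Qed.

Let ell_norm_lt u m : ell_norm u < m -> exists2 l, adm u l & l < m.
Proof.
move=> um; have m0 : 0 < m - ell_norm u by rewrite subr_gt0.
have [l ul] := inf_adherent m0 (conj (adm_nonempty u) (adm_lb u)).
by rewrite addrC subrK => lm; exists l.
Qed.

Lemma ell_normD u v : ell_norm (u + v) <= ell_norm u + ell_norm v.
Proof.
apply/ler_addgt0Pr => e e0; have e2 : 0 < e / 2 by rewrite divr_gt0.
have [l [l0 lu] le] : exists2 l, adm u l & l < ell_norm u + e / 2.
  by apply: ell_norm_lt; rewrite ltrDl.
have [m [m0 mv] me] : exists2 l, adm v l & l < ell_norm v + e / 2.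
  by apply: ell_norm_lt; rewrite ltrDl.
apply: (@le_trans _ _ (l + m)); last first.
  by rewrite (le_trans (ltW (ltrD le me)))// [in leRHS](splitr e) addrACA.
apply: ge_inf; first exact: adm_lb.
split; first by rewrite addr_gt0.
rewrite (le_trans (conv_comb u v l0 m0))//.
have lm : 0 < l + m by rewrite addr_gt0.
rewrite (@le_trans _ _ ((l / (l + m))%:E * 1 + (m / (l + m))%:E * 1)%E)//.
  by rewrite leeD// lee_wpmul2l// lee_fin divr_ge0 ?ltW.
by rewrite !mule1 -EFinD lee_fin -mulrDl divff// gt_eqF.
Qed.

Lemma ell_normZ a u : ell_norm (a *: u) = `|a| * ell_norm u.
Proof.
have le b w : b != 0 -> ell_norm (b *: w) <= `|b| * ell_norm w.
  move=> b0; rewrite -ler_pdivrMl ?normr_gt0//.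
  apply: lb_le_inf; first exact: adm_nonempty.
  move=> l [l0 lw].
  rewrite ler_pdivrMl ?normr_gt0//; apply: ge_inf; first exact: adm_lb.
  split.
    by rewrite mulr_gt0// normr_gt0.
  by rewrite scaleE.
have [->|a0] := eqVneq a 0.
  rewrite scale0r normr0 mul0r; apply/eqP; rewrite eq_le ell_norm_ge0 andbT.
  apply/ler_addgt0Pr => e e0; rewrite add0r; apply: ge_inf; first exact: adm_lb.
  split => //.
  rewrite [X in modular X](_ : _ = fun k => 0 * 0).
    rewrite (le_trans (@modular_scale 0 (fun=> 0) _)) ?lexx ?ler01//.
    by rewrite mul0e.
  by apply/funext => k; rewrite !mul0r.
apply/eqP; rewrite eq_le le//=.
have := le a^-1 (a *: u); rewrite invr_eq0 a0 scalerA mulVf// scale1r normfV.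
by rewrite ler_pdivlMl ?normr_gt0//; apply.
Qed.

Lemma ell_norm_eq0 u : ell_norm u = 0 -> u = 0.
Proof.
move=> u0; apply/val_inj/funext => k /=; apply/normr0_eq0/eqP.
rewrite eq_le normr_ge0 andbT; apply/ler_addgt0Pr => e e0; rewrite add0r.
have [l [l0 lu] le] : exists2 l, adm u l & l < e.
  by apply: ell_norm_lt; rewrite u0.
have := modular_le1 k lu.
rewrite normrM normfV (gtr0_norm l0) ler_pdivrMr// mul1r => /le_trans; apply.
exact: ltW.
Qed.

HB.instance Definition _ :=
  Lmodule_isNormed.Build R ell ell_normD ell_normZ ell_norm_eq0.

End variable_lebesgue.

Section finite_content.
Context {R : realType} (p : finite_exponent R).

Definition finite_content (A : set nat) :=
  exists2 B : R, 1 < B & (\esum_(k in A) (B `^ (- p k))%:E < +oo)%E.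

Lemma finite_content_sub A B : A `<=` B -> finite_content B -> finite_content A.
Proof.
move=> AB [C C1 BC]; exists C => //; apply: le_lt_trans BC.
apply: ge_ereal_sup => _ [F [finF FA] <-]; apply: ereal_sup_ubound.
by exists F => //; split => //; exact: subset_trans AB.
Qed.

Let esum_content_le (B C : R) (A : set nat) : 1 < B -> B <= C ->
  (\esum_(k in A) (C `^ (- p k))%:E <= \esum_(k in A) (B `^ (- p k))%:E)%E.
Proof.
move=> B1 BC; have B0 := lt_trans ltr01 B1; have C0 := lt_le_trans B0 BC.
apply: le_esum => k _; rewrite lee_fin !powRN lef_pV2 ?posrE ?powR_gt0//.
by rewrite ge0_ler_powR ?nnegrE ?(ltW B0) ?(ltW C0)// (le_trans ler01)// fexpo_ge1.
Qed.

Lemma finite_contentU A B :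
  finite_content A -> finite_content B -> finite_content (A `|` B).
Proof.
move=> [C C1 AC] [D D1 BD].
exists (Num.max C D); first by rewrite lt_max C1.
set M := Num.max C D; have M1 : 1 < M by rewrite lt_max C1.
pose f k := (M `^ (- p k))%:E.
have f0 k : (0 <= f k)%E by rewrite lee_fin powR_ge0.
apply: (@le_lt_trans _ _ (\esum_(k in A) f k + \esum_(k in B) f k)%E).
  rewrite [leLHS]esum_mkcond [X in (_ <= X + _)%E]esum_mkcond.
  rewrite [X in (_ <= _ + X)%E]esum_mkcond -esumD; last 2 first.
    by move=> k _; case: ifPn.
    by move=> k _; case: ifPn.
  apply: le_esum => k _; rewrite in_setU.
  by case: (k \in A); case: (k \in B) => //=; rewrite ?adde0 ?add0e// leeDl.
apply: lte_add_pinfty.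
  by apply: le_lt_trans AC; apply: esum_content_le => //; rewrite le_max lexx.
by apply: le_lt_trans BD; apply: esum_content_le => //; rewrite le_max lexx orbT.
Qed.

Record content_set := ContentSet {
  content_val :> set nat ;
  content_valP : finite_content content_val }.

Definition content_setU (A B : content_set) : content_set :=
  ContentSet (finite_contentU (content_valP A) (content_valP B)).

Lemma content_set_inj (A B : content_set) : A = B :> set nat -> A = B.
Proof.
by case: A B => [A Ac] [B Bc] /= AB; subst; congr ContentSet; exact: Prop_irrelevance.
Qed.

Lemma indic_ellp (A : content_set) : (\1_A : nat -> R) \in ellp p.
Proof.
have [B B1 AB] := content_valP A; have B0 := lt_trans ltr01 B1.
apply/asboolP; exists B => //; rewrite /modular.
set X := (_ |` _); have -> : X = [set 0%E].
  by apply/seteqP; split=> [_ [->//|[k //]]|_ ->]; left.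
rewrite ereal_sup1 adde0; apply: le_lt_trans AB.
rewrite [leLHS]esum_mkcond [leRHS]esum_mkcond; apply: le_esum => k _.
rewrite indicE; case: ifPn => _ /=; last first.
  by case: ifPn => // _; rewrite lee_fin powR_ge0.
case: (k \in content_val A) => /=.
  by rewrite mul1r normfV (gtr0_norm B0) -(powR_inv1 (ltW B0)) -powRrM mulN1r.
by rewrite mul0r normr0 powR0// gt_eqF// (lt_le_trans ltr01)// fexpo_ge1.
Qed.

Definition ell_indic (A : content_set) : ell p := Ell (indic_ellp A).

Definition ellb : {pred ell p} :=
  fun x => `[< exists M : R, forall k, x k != 0 -> p k <= M >].

Lemma ellb_submod_closed : submod_closed ellb.
Proof.
split; first by apply/asboolP; exists 0 => k; rewrite eqxx.
move=> a x y /asboolP[M xM] /asboolP[N yN]; apply/asboolP.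
exists (Num.max M N) => k /=; rewrite le_max !fctE => xy.
have [xk|/xM->//] := eqVneq (x k) 0; rewrite yN ?orbT//.
by apply: contra xy => /eqP yk; rewrite xk yk scaler0 addr0.
Qed.

HB.instance Definition _ :=
  GRing.isSubmodClosed.Build R (ell p) ellb ellb_submod_closed.

Definition ell_germ := quot_closure ellb.

HB.instance Definition _ := NormedModule.on ell_germ.

Definition omega (A : content_set) : R := `|\pi_ell_germ (ell_indic A)|.

Definition ell_simple : {pred ell p} :=
  fun x => `[< exists n (alpha : 'I_n -> R) (A : 'I_n -> content_set),
    trivIset setT A /\ x = \sum_(i < n) alpha i *: ell_indic (A i) >].

Implicit Types x y : ell p.

Let simple x := finite_set (range x) /\ finite_content [set k | x k != 0].

Let simple_comb a x y : simple x -> simple y -> simple (a *: x + y).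
Proof.
move=> [xf xc] [yf yc]; split.
  apply: (@sub_finite_set _ _ [set a * u + v | u in range x & v in range y]).
    by move=> _ [k _ <-]; exists (x k); [exists k|exists (y k) => //; exists k].
  exact: finite_image2.
apply: finite_content_sub (finite_contentU xc yc) => k /= xy.
have [xk|xk] := eqVneq (x k) 0; [right|by left].
apply: contra xy => /eqP yk.
by rewrite !fctE xk yk scaler0 addr0.
Qed.

Let simple0 : simple 0.
Proof.
split; first by apply: (@sub_finite_set _ _ [set 0]) => // _ [k _ <-].
have [A|] := pselect (finite_content set0).
  by apply: finite_content_sub A => k /=; rewrite eqxx.
by case; exists 2; rewrite ?ltr1n// esum_set0.
Qed.

Let simple_indic (A : content_set) : simple (ell_indic A).
Proof.
split.
  apply: (@sub_finite_set _ _ [set 0; 1]) => // _ [k _ <-] /=.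
  by rewrite indicE; case: (_ \in _); [right|left].
apply: finite_content_sub (content_valP A) => k /=.
by rewrite indicE; have [/set_mem//|] := boolP (k \in _); rewrite eqxx.
Qed.

Let sumE n (F : 'I_n -> ell p) k : (\sum_i F i) k = \sum_i F i k.
Proof. by apply: (big_morph (fun x : ell p => x k)). Qed.

Lemma ell_simpleP x : reflect
  (finite_set (range x) /\ finite_content [set k | x k != 0])
  (x \in ell_simple).
Proof.
apply: (iffP (asboolP _)) => [[n [alpha [A [_ ->]]]]|[xf xc]].
  apply: (big_rec simple) => [|i y _ ys]; first exact: simple0.
  by apply: simple_comb => //; exact: simple_indic.
have /finite_seqP[r rE] := xf.
pose s := undup [seq v <- r | v != 0].
have us : uniq s := undup_uniq _.
have ms k : x k != 0 -> x k \in s.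
  move=> xk; rewrite mem_undup mem_filter xk/=.
  suff : [set` r] (x k) by [].
  by rewrite -rE; exists k.
have s0 i : (i < size s)%N -> s`_i != 0.
  by move=> /(mem_nth 0); rewrite mem_undup mem_filter => /andP[].
have Ac (i : 'I_(size s)) : finite_content [set k | x k = s`_i].
  by apply: finite_content_sub xc => k /= ->; exact: s0.
exists (size s), (fun i => s`_i), (fun i => ContentSet (Ac i)); split.
  move=> i j _ _ [k [/= -> /eqP]].
  by rewrite nth_uniq// => /eqP/val_inj.
apply/val_inj/funext => k /=; rewrite sumE.
have [xk|xk] := eqVneq (x k) 0.
  rewrite big1// => i _ /=; rewrite fctE indicE memNset ?scaler0//= xk.
  by apply/eqP; rewrite eq_sym; exact: s0.
have ks : (index (x k) s < size s)%N by rewrite index_mem ms.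
rewrite (bigD1 (Ordinal ks))//= big1 ?addr0.
  rewrite fctE indicE mem_set/= ?nth_index ?ms//.
  by rewrite /GRing.scale/= mulr1.
move=> i ik; rewrite /= fctE indicE memNset ?scaler0//= => xi.
move/eqP: ik; apply; apply/val_inj => /=.
by rewrite xi index_uniq.
Qed.

Lemma ell_simple_submod_closed : submod_closed ell_simple.
Proof.
split; first by apply/ell_simpleP; exact: simple0.
move=> a x y /ell_simpleP xs /ell_simpleP ys; apply/ell_simpleP.
exact: simple_comb.
Qed.

HB.instance Definition _ :=
  GRing.isSubmodClosed.Build R (ell p) ell_simple ell_simple_submod_closed.

End finite_content.

Arguments ellb {R} p _.
Arguments ell_simple {R} p _.

Section pba.
Context {R : realType} (p : finite_exponent R).

Implicit Types (mu nu : content_set p -> R) (C D : R).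

(* Division in \bar R has the required conventions: 0^-1 = +oo and
   0 * +oo = 0, so that 0 / 0 = 0 and c / 0 = +oo for c > 0.  Disjoint families
   may repeat the empty set, where a finitely additive mu vanishes. *)
Definition omega_bounded mu C :=
  forall n (A : 'I_n -> content_set p), trivIset setT A ->
    (\sum_(i < n) (`|mu (A i)|%:E / (omega (A i))%:E) <= C%:E)%E.

Definition finitely_additive mu :=
  forall A B : content_set p, A `&` B = set0 ->
    mu (content_setU A B) = mu A + mu B.

Definition pbap : {pred content_set p -> R} :=
  fun mu => `[< finitely_additive mu /\ exists2 C, 0 < C & omega_bounded mu C >].

Let inv_ge0 (A : content_set p) : (0 <= ((omega A)%:E)^-1)%E.
Proof. by rewrite inve_ge0 lee_fin; exact: normr_ge0. Qed.

Let ratio_ge0 mu A : (0 <= `|mu A|%:E / (omega A)%:E)%E.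
Proof. by rewrite mule_ge0. Qed.

Let bounded_comb a mu nu C D :
  omega_bounded mu C -> omega_bounded nu D ->
  omega_bounded (a *: mu + nu) (`|a| * C + D).
Proof.
move=> muC nuD n A tA.
apply: (@le_trans _ _ (`|a|%:E * (\sum_(i < n) (`|mu (A i)|%:E / (omega (A i))%:E))
   + \sum_(i < n) (`|nu (A i)|%:E / (omega (A i))%:E))%E).
  rewrite ge0_sume_distrr// -big_split/=; apply: lee_sum => i _.
  rewrite muleA -EFinM -ge0_muleDl ?lee_fin ?mulr_ge0//.
  rewrite lee_wpmul2r// -EFinD lee_fin !fctE.
  by rewrite (le_trans (ler_normD _ _))// normrM.
rewrite EFinD EFinM leeD//; last exact: nuD.
by rewrite lee_wpmul2l ?lee_fin//; exact: muC.
Qed.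

Let bounded0 C : 0 <= C -> omega_bounded 0 C.
Proof.
by move=> C0 n A _; rewrite big1 ?lee_fin// => i _; rewrite normr0 mul0e.
Qed.

Lemma pba_submod_closed : submod_closed pbap.
Proof.
split.
  apply/asboolP; split; first by move=> A B _; rewrite [RHS]addr0.
  by exists 1 => //; exact: bounded0.
move=> a mu nu /asboolP[mua [C C0 muC]] /asboolP[nua [D D0 nuD]].
apply/asboolP; split.
  by move=> A B AB; rewrite !fctE mua// nua// scalerDr addrACA.
exists (`|a| * C + D); last exact: bounded_comb.
by rewrite ltr_wpDl// mulr_ge0// ltW.
Qed.

HB.instance Definition _ :=
  GRing.isSubmodClosed.Build R (content_set p -> R) pbap pba_submod_closed.

Record pba := Pba { pba_fun :> content_set p -> R ; pba_funP : pba_fun \in pbap }.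

HB.instance Definition _ := [isSub for pba_fun].
HB.instance Definition _ := [Choice of pba by <:].
HB.instance Definition _ := [SubChoice_isSubLmodule of pba by <:].

Definition pba_norm (mu : pba) : R := inf [set C | 0 < C /\ omega_bounded mu C].

Implicit Types u v : pba.

Let adm u := [set C | 0 < C /\ omega_bounded u C].

Let adm_nonempty u : adm u !=set0.
Proof. by have /asboolP[_ [C C0 uC]] := pba_funP u; exists C. Qed.

Let adm_lb u : has_lbound (adm u).
Proof. by exists 0 => C [/ltW]. Qed.

Lemma pba_norm_ge0 u : 0 <= pba_norm u.
Proof.
apply: lb_le_inf; first exact: adm_nonempty.
by move=> C [/ltW].
Qed.

Let pba_norm_lt u e : pba_norm u < e -> exists2 C, adm u C & C < e.
Proof.
move=> um; have e0 : 0 < e - pba_norm u by rewrite subr_gt0.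
have [C uC] := inf_adherent e0 (conj (adm_nonempty u) (adm_lb u)).
by rewrite addrC subrK => Ce; exists C.
Qed.

Lemma pba_normD u v : pba_norm (u + v) <= pba_norm u + pba_norm v.
Proof.
apply/ler_addgt0Pr => e e0; have e2 : 0 < e / 2 by rewrite divr_gt0.
have [C [C0 uC] Ce] : exists2 C, adm u C & C < pba_norm u + e / 2.
  by apply: pba_norm_lt; rewrite ltrDl.
have [D [D0 vD] De] : exists2 C, adm v C & C < pba_norm v + e / 2.
  by apply: pba_norm_lt; rewrite ltrDl.
apply: (@le_trans _ _ (C + D)); last first.
  by rewrite (le_trans (ltW (ltrD Ce De)))// [in leRHS](splitr e) addrACA.
apply: ge_inf; first exact: adm_lb.
split; first by rewrite addr_gt0.
by have := @bounded_comb 1 u v C D uC vD; rewrite scale1r normr1 mul1r.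
Qed.

Lemma pba_normZ a u : pba_norm (a *: u) = `|a| * pba_norm u.
Proof.
have le b w : b != 0 -> pba_norm (b *: w) <= `|b| * pba_norm w.
  move=> b0; rewrite -ler_pdivrMl ?normr_gt0//.
  apply: lb_le_inf; first exact: adm_nonempty.
  move=> C [C0 wC].
  rewrite ler_pdivrMl ?normr_gt0//; apply: ge_inf; first exact: adm_lb.
  split; first by rewrite mulr_gt0// normr_gt0.
  by have := bounded_comb b wC (bounded0 (lexx 0)); rewrite !addr0.
have [->|a0] := eqVneq a 0.
  rewrite scale0r normr0 mul0r; apply/eqP; rewrite eq_le pba_norm_ge0 andbT.
  apply/ler_addgt0Pr => e e0; rewrite add0r; apply: ge_inf; first exact: adm_lb.
  by split => //; apply: bounded0; exact: ltW.
apply/eqP; rewrite eq_le le//=.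
have := le a^-1 (a *: u); rewrite invr_eq0 a0 scalerA mulVf// scale1r normfV.
by rewrite ler_pdivlMl ?normr_gt0//; apply.
Qed.

Lemma pba_norm_eq0 u : pba_norm u = 0 -> u = 0.
Proof.
move=> u0; apply/val_inj/funext => A /=; apply/normr0_eq0/eqP.
have : (`|u A|%:E / (omega A)%:E <= 0)%E.
  apply/lee_addgt0Pr => e e0; rewrite add0e.
  have [C [C0 uC] Ce] : exists2 C, adm u C & C < e.
    by apply: pba_norm_lt; rewrite u0.
  have := uC 1%N (fun=> A); rewrite big_ord1 => /(_ _)/le_trans; apply.
    by move=> i j _ _ _; rewrite (ord1 i) (ord1 j).
  by rewrite lee_fin ltW.
apply: contraTT => uA; rewrite -ltNge; apply: mule_gt0.
  by rewrite lte_fin lt_neqAle eq_sym normr_ge0 andbT (contra _ uA)// => /eqP->.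
by rewrite lt_neqAle inv_ge0 andbT eq_sym inve_eq0.
Qed.

HB.instance Definition _ :=
  Lmodule_isNormed.Build R pba pba_normD pba_normZ pba_norm_eq0.

End pba.

(* Main.v *)
From HB Require Import structures.
Require Import Defs.
From mathcomp Require Import all_boot all_order all_algebra.
From mathcomp Require Import all_classical all_reals all_analysis.
From mathcomp Require Import generic_quotient lra.

(* Write x 1_A for the restriction of x to A. For a bounded functional f and an
   ideal I of subsets of N, the set function A |-> f (x 1_A) has variation at
   most |f| |x| on I, so its limit along the directed set I exists and is again
   a bounded functional of x; call functionals equal to their own limit
   I-regular. They are determined by their values on elements supported in I.
   Every f splits uniquely as g1 + g2 + g3, where g1 is regular for finite sets
   and agrees with f on the unit vectors, g2 is regular for sets of finite
   content and agrees with f - g1 on indicators, and g3 vanishes on S_p. By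
   Hoelder's inequality and its converse the g1 form the space l^p', and the g3
   form the dual of l^p modulo the closure of S_p. The set functions
   A |-> g2 1_A are exactly those in pba_omega, since g2 vanishes on l^p_b and
   the germ norm of a disjoint sum is the maximum of the germ norms. *)

Set Implicit Arguments.
Unset Strict Implicit.
Unset Printing Implicit Defensive.

Import Order.TTheory GRing.Theory Num.Theory.
Import numFieldNormedType.Exports.

Local Open Scope classical_set_scope.
Local Open Scope ring_scope.
Local Open Scope quotient_scope.

(** * Functionals on normed spaces *)

Section normed.
Context {R : realType}.

Lemma normr_eps0 (V : normedModType R) (x : V) C :
  (forall e, 0 < e -> `|x| <= C * e) -> x = 0.
Proof.
move=> h; apply/normr0_eq0/eqP; rewrite eq_le normr_ge0 andbT.
apply/ler_addgt0Pr => e e0; rewrite add0r.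
have C1 : 0 < `|C| + 1 by rewrite ltr_wpDl.
apply: (le_trans (h (e / (`|C| + 1)) _)); first by rewrite divr_gt0.
by rewrite mulrA ler_pdivrMr// mulrC ler_wpM2l ?(ltW e0)//
  (le_trans (ler_norm _))// lerDl.
Qed.

(** Trivial kernels make the linear relation [r] single-valued both ways; any choice of values then
    gives linear, mutually inverse maps. *)
Lemma isomorphic_rel (E F : normedModType R) (r : E -> F -> Prop) (K : R) :
  (forall a x y u v, r x u -> r y v -> r (a *: x + y) (a *: u + v)) ->
  (forall x, exists2 u, r x u & `|u| <= K * `|x|) ->
  (forall u, exists2 x, r x u & `|x| <= K * `|u|) ->
  (forall u, r 0 u -> u = 0) -> (forall x, r x 0 -> x = 0) ->
  isomorphic E F.
Proof.
move=> rlin rE rF r0F r0E.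
have rF1 x u v : r x u -> r x v -> u = v.
  move=> xu xv; apply/eqP; rewrite -subr_eq0; apply/eqP/r0F.
  have := rlin (-1) x x v u xv xu.
  by rewrite !scaleN1r addNr addrC.
have rE1 x y u : r x u -> r y u -> x = y.
  move=> xu yu; apply/eqP; rewrite -subr_eq0; apply/eqP/r0E.
  have := rlin (-1) y x u u yu xu.
  by rewrite !scaleN1r addNr addrC.
have rE' x : exists u, r x u /\ `|u| <= K * `|x| by have [u] := rE x; exists u.
have rF' u : exists x, r x u /\ `|x| <= K * `|u| by have [x] := rF u; exists x.
have [f fP] := choice rE'; have [g gP] := choice rF'.
have flin : linear f.
  by move=> a x y; apply: rF1 (fP _).1 _; apply: rlin; exact: (fP _).1.
have glin : linear g.
  by move=> a u v; apply: rE1 (gP _).1 _; apply: rlin; exact: (gP _).1.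
pose fL : {linear E -> F} := HB.pack f (GRing.isLinear.Build R E F *:%R f flin).
pose gL : {linear F -> E} := HB.pack g (GRing.isLinear.Build R F E *:%R g glin).
exists fL, gL; split; first by move=> x; apply: rE1 (gP _).1 (fP _).1.
- by move=> u; apply: rF1 (fP _).1 (gP _).1.
- by exists K => x; exact: (fP x).2.
- by exists K => u; exact: (gP u).2.
Qed.

Lemma dual_of (E : normedModType R) (f : E -> R) C :
  linear f -> (forall x, `|f x| <= C * `|x|) ->
  exists g : dual E, g =1 f.
Proof.
move=> fl fC; have fP : f \in @functional R E by apply/asboolP; split => //; exists C.
by exists (Dual fP).
Qed.

Lemma dual_norm_le_ub (E : normedModType R) (f : dual E) C : 0 <= C ->
  (forall x, `|f x| <= C * `|x|) -> `|f| <= C.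
Proof.
move=> C0 fC; apply: dual_norm_le => x x1; rewrite (le_trans (fC x))//.
by rewrite ler_piMr.
Qed.

Lemma dual_ub (E : normedModType R) (f : dual E) x : `|f x| <= `|f| * `|x|.
Proof. exact: dual_norm_ub. Qed.

Lemma dual0 (E : normedModType R) (f : dual E) : f 0 = 0.
Proof. by rewrite -(scale0r (0 : E)) dualZ mul0r. Qed.

Lemma dualD (E : normedModType R) (f : dual E) x y : f (x + y) = f x + f y.
Proof. by have := dual_lin f 1 x y; rewrite !scale1r. Qed.

Lemma dualN (E : normedModType R) (f : dual E) x : f (- x) = - f x.
Proof. by rewrite -scaleN1r dualZ mulN1r. Qed.

Lemma dualB (E : normedModType R) (f : dual E) x y : f (x - y) = f x - f y.
Proof. by rewrite dualD dualN. Qed.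

Lemma dual_comb (E : normedModType R) a (f g : dual E) x :
  (a *: f + g) x = a * f x + g x.
Proof. by []. Qed.

Lemma dual_closurep0 (E : normedModType R) (S : submodClosed E) (f : dual E) x :
  (forall s, s \in S -> f s = 0) -> x \in closurep S -> f x = 0.
Proof.
move=> fS /closurepP Sx; apply: (@normr_eps0 R^o _ `|f|) => e e0.
have [s /fS fs0 xs] := Sx e e0; rewrite -[f x]subr0 -fs0 -dualB.
by rewrite (le_trans (dual_ub _ _))// ler_wpM2l// ltW.
Qed.

Definition linear_on (E : normedModType R) (S : {pred E}) (f : E -> R) :=
  forall a, {in S &, forall x y, f (a *: x + y) = a * f x + f y}.

(* The inf-convolution of [f] with [C * `|x|] is [C]-Lipschitz. *)
Lemma linear_on_closurep (E : normedModType R) (S : submodClosed E) (f : E -> R) C :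
  0 <= C -> linear_on S f -> {in S, forall x, `|f x| <= C * `|x|} ->
  exists g : E -> R, [/\ linear_on (closurep S) g,
    forall x, x \in closurep S -> `|g x| <= C * `|x| & {in S, g =1 f}].
Proof.
move=> C0 flin fC.
have f0 : f 0 = 0.
  by have := flin 1 0 0 (rpred0 _) (rpred0 _); rewrite scale1r addr0 mul1r; lra.
have fB x y : x \in S -> y \in S -> f (x - y) = f x - f y.
  move=> xS yS; have := flin (-1) y x yS xS.
  by rewrite scaleN1r mulN1r addrC [in RHS]addrC.
pose V x := [set f s + C * `|x - s| | s in [set` S]].
have V0 x : V x !=set0 by exists (f 0 + C * `|x - 0|), 0 => //=; exact: rpred0.
have Vlb x : lbound (V x) (- (C * `|x|)).
  move=> _ [s /= sS <-]; have := fC _ sS; rewrite ler_norml => /andP[+ _].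
  have : C * `|s| <= C * `|x| + C * `|x - s|.
    rewrite -mulrDr ler_wpM2l// -[X in `|X|](subKr x) (le_trans (ler_normB _ _))//.
  lra.
have Vhl x : has_lbound (V x) by exists (- (C * `|x|)).
pose g x := inf (V x).
have gs x s : s \in S -> g x <= f s + C * `|x - s|.
  by move=> sS; apply: ge_inf => //; exists s.
have gL x y : g x <= g y + C * `|x - y|.
  rewrite -lerBlDr; apply: lb_le_inf => // _ [s /= sS <-].
  rewrite lerBlDr (le_trans (gs x s sS))// -addrA lerD2l -mulrDr ler_wpM2l//.
  by rewrite [leRHS]addrC ler_distD.
have gS : {in S, g =1 f}.
  move=> s sS; apply/eqP; rewrite eq_le; apply/andP; split.
    by rewrite (le_trans (gs s s sS))// subrr normr0 mulr0 addr0.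
  apply: lb_le_inf => // _ [t /= tS <-].
  have stS : s - t \in S by rewrite -scaleN1r rpredD ?rpredZ.
  have := fC _ stS; rewrite fB// ler_norml => /andP[_]; lra.
exists g; split => //; last first.
  move=> x _; have g0 : g 0 = 0 by rewrite gS ?rpred0.
  have := gL 0 x; have := gL x 0; rewrite subr0 sub0r normrN g0.
  by rewrite ler_norml; lra.
(* Linearity passes from [S], where [g] is [f], to nearby points; the three Lipschitz errors add up
   to 2 C (|a| + 1) e. *)
move=> a x y /closurepP Sx /closurepP Sy; apply/eqP; rewrite -subr_eq0; apply/eqP.
apply: (@normr_eps0 R^o _ (2 * C * (`|a| + 1))) => e e0.
have [s sS xs] := Sx e e0; have [t tS yt] := Sy e e0.
have gd u v d : `|u - v| <= d -> `|g u - g v| <= C * d.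
  move=> uv; apply: (@le_trans _ _ (C * `|u - v|)); last by rewrite ler_wpM2l.
  by have := gL u v; have := gL v u; rewrite distrC ler_norml; lra.
have h1 := gd _ _ _ (ltW xs); have h2 := gd _ _ _ (ltW yt).
have h3 : `|g (a *: x + y) - g (a *: s + t)| <= C * (`|a| * e + e).
  apply: gd; rewrite opprD addrACA -scalerBr (le_trans (ler_normD _ _))//.
  by rewrite normrZ lerD ?ler_wpM2l// ltW.
have h4 : `|a * (g x - g s)| <= `|a| * (C * e) by rewrite normrM ler_wpM2l.
have : g (a *: s + t) = a * g s + g t by rewrite !gS ?rpredD ?rpredZ// flin.
rewrite mulrBr in h4; move: h1 h2 h3 h4; rewrite !ler_norml; nra.
Qed.

End normed.

(** * Restriction and regular functionals *)

Section restriction.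
Context {R : realType} (q : exponent R).
Implicit Types (x y : ell q) (A B D : set nat).

Lemma ell_ext x y : (forall k, x k = y k) -> x = y.
Proof. by move=> xy; apply/val_inj/funext. Qed.

Lemma ell_linearE a x y k : (a *: x + y) k = a * x k + y k.
Proof. by []. Qed.

Lemma ell_norm_le_adm x l :
  0 < l -> (modular q (fun k => x k / l)%R <= 1)%E -> `|x| <= l.
Proof. by move=> l0 xl; apply: ge_inf => //; exists 0 => m [/ltW]. Qed.

Lemma modular0 : modular q (fun=> 0) = 0%E.
Proof.
have := @modular_scale R q 0 (fun=> 0); rewrite lexx ler01 mul0e => /(_ isT) h.
apply/eqP; rewrite eq_le modular_ge0 andbT (le_trans _ h)//.
by apply: modular_le => k; rewrite normr0.
Qed.

(** The norm is an infimum, so some admissible scaling lies below [l], and it stays admissible when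
    enlarged to [l]. *)
Lemma ell_adm_norm_lt x l :
  `|x| < l -> (modular q (fun k => x k / l)%R <= 1)%E.
Proof.
move=> xl; pose V := [set l | 0 < l /\ (modular q (fun k => x k / l)%R <= 1)%E].
have l0 : 0 < l by rewrite (le_lt_trans _ xl).
have hi : has_inf V.
  split; last by exists 0 => m [/ltW].
  (* Without admissible scalings the norm would be the default [inf set0 = 0], so [x = 0] and [l]
     would be admissible after all. *)
  apply: contrapT => V0; apply: (V0); exists l; split => //.
  have x0 : x = 0.
    apply: ell_norm_eq0; rewrite /ell_norm -/V.
    have -> : V = set0 by apply/seteqP; split => // m Vm; apply: V0; exists m.
    exact: inf0.
  rewrite (_ : (fun _ => _) = fun=> 0) ?modular0//.
  by apply/funext => k; rewrite x0 mul0r.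
have d0 : 0 < l - `|x| by rewrite subr_gt0.
have [m [m0 xm]] := inf_adherent d0 hi.
rewrite [inf V](_ : _ = `|x|)// addrC subrK => ml; apply: le_trans xm.
apply: modular_le => k; rewrite !normrM ler_wpM2l// !normfV.
by rewrite !gtr0_norm// lef_pV2// ltW.
Qed.

Lemma ellp_le (u v : nat -> R) :
  (forall k, `|u k| <= `|v k|) -> v \in ellp q -> u \in ellp q.
Proof.
move=> uv /asboolP[l l0 vl]; apply/asboolP; exists l => //.
apply: le_lt_trans vl; apply: modular_le => k.
by rewrite !normrM ler_wpM2r.
Qed.

Lemma ell_norm_le x y : (forall k, `|x k| <= `|y k|) -> `|x| <= `|y|.
Proof.
move=> xy; apply/ler_addgt0Pr => e e0; apply: ell_norm_le_adm.
  by rewrite ltr_wpDl.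
have /ell_adm_norm_lt : `|y| < `|y| + e by rewrite ltrDl.
apply: le_trans.
by apply: modular_le => k; rewrite !normrM ler_wpM2r.
Qed.

Lemma ell_res_subproof A x : (fun k => \1_A k * x k) \in ellp q.
Proof.
apply: ellp_le (ell_seqP x) => k; rewrite normrM ler_piMl//.
by rewrite indicE; case: (k \in A); rewrite ?normr1 ?normr0.
Qed.

Definition ell_res A x : ell q := Ell (ell_res_subproof A x).

Lemma ell_resE A x k : ell_res A x k = \1_A k * x k.
Proof. by []. Qed.

Lemma ell_res_comb A a x y : ell_res A (a *: x + y) = a *: ell_res A x + ell_res A y.
Proof. by apply: ell_ext => k; rewrite ell_linearE !ell_resE ell_linearE; lra. Qed.

Lemma ell_res_norm A x : `|ell_res A x| <= `|x|.
Proof.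
apply: ell_norm_le => k; rewrite ell_resE indicE.
by case: (k \in A); rewrite ?mul1r// mul0r normr0.
Qed.

Lemma ell_resI A B x : ell_res A (ell_res B x) = ell_res (A `&` B) x.
Proof. by apply: ell_ext => k; rewrite !ell_resE indicI/= mulrA. Qed.

Lemma ell_resU A B x : A `&` B = set0 ->
  ell_res (A `|` B) x = ell_res A x + ell_res B x.
Proof.
move=> AB; apply: ell_ext => k.
rewrite [RHS](_ : _ = ell_res A x k + ell_res B x k)// !ell_resE !indicE in_setU -mulrDl.
have : ~~ ((k \in A) && (k \in B)) by rewrite -in_setI AB in_set0.
by case: (k \in A); case: (k \in B) => //=; rewrite ?addr0 ?add0r.
Qed.

Lemma ell_res_subK A B x : A `<=` B -> ell_res B (ell_res A x) = ell_res A x.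
Proof. by move=> /setIidPr AB; rewrite ell_resI AB. Qed.

(** * Limits along ideals of sets *)

Definition set_ideal (I : set (set nat)) :=
  [/\ I set0, forall A B, I A -> I B -> I (A `|` B) &
     forall A B, A `<=` B -> I B -> I A].

Definition lim_along (I : set (set nat)) (u : set nat -> R) (l : R) :=
  forall e, 0 < e -> exists2 A, I A &
    forall B, I B -> A `<=` B -> `|l - u B| <= e.

Lemma lim_along_comb I u v a l m : set_ideal I ->
  lim_along I u l -> lim_along I v m ->
  lim_along I (fun A => a * u A + v A) (a * l + m).
Proof.
move=> [_ IU _] ul vm e e0; have e2 : 0 < e / 2 by rewrite divr_gt0.
have a0 : 0 < `|a| + 1 by rewrite ltr_wpDl.
have [A IA ulA] := ul _ (divr_gt0 e2 a0); have [B IB vmB] := vm _ e2.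
exists (A `|` B) => [|D ID]; first exact: IU.
rewrite subUset => -[AD BD]; rewrite opprD addrACA -mulrBr.
rewrite (le_trans (ler_normD _ _))// [leRHS]splitr lerD ?vmB// normrM.
have := ulA D ID AD; rewrite ler_pdivlMr// => /(le_trans _); apply.
by rewrite mulrC ler_wpM2l// lerDl.
Qed.

Lemma lim_along_unique I u l m : set_ideal I ->
  lim_along I u l -> lim_along I u m -> l = m.
Proof.
move=> [_ IU _] ul um; apply/eqP; rewrite -subr_eq0; apply/eqP.
apply: (@normr_eps0 R R^o _ 2) => e e0.
have [A IA ulA] := ul e e0; have [B IB umB] := um e e0.
have := ulA (A `|` B) (IU _ _ IA IB) (@subsetUl _ _ _).
have := umB (A `|` B) (IU _ _ IA IB) (@subsetUr _ _ _).
by rewrite !ler_norml; lra.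
Qed.

Lemma lim_along_le I u l c :
  lim_along I u l -> (forall A, I A -> `|u A| <= c) -> `|l| <= c.
Proof.
move=> ul uc; apply/ler_addgt0Pr => e e0; have [A IA ulA] := ul e e0.
have := ulA A IA (@subset_refl _ _); have := uc A IA.
by rewrite !ler_norml; lra.
Qed.

Lemma lim_along_near_cst I u l A : I A ->
  (forall B, I B -> A `<=` B -> u B = l) -> lim_along I u l.
Proof.
by move=> IA ul e e0; exists A => // B IB AB; rewrite ul// subrr normr0 ltW.
Qed.

(* The finitely additive set function [A |-> f (ell_res A x)] has bounded
   variation, so it is small off a set which almost attains the supremum of
   [f (ell_res A x) - f (ell_res B x)] over disjoint [A], [B]. *)
Lemma lim_along_exists I (T : submodClosed (ell q)) (f : ell q -> R) C x :
  set_ideal I -> 0 <= C -> linear_on T f ->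
  (forall x, x \in T -> `|f x| <= C * `|x|) ->
  (forall A, I A -> ell_res A x \in T) ->
  exists l, lim_along I (fun A => f (ell_res A x)) l.
Proof.
move=> [I0 IU IS] C0 flin fC xT.
have tail e : 0 < e -> exists2 A, I A &
    forall B, I B -> A `&` B = set0 -> `|f (ell_res B x)| <= e.
  pose W := [set w | exists A B, [/\ I A, I B, A `&` B = set0 &
    w = f (ell_res A x) - f (ell_res B x)]].
  have fB u v : u \in T -> v \in T -> f (u - v) = f u - f v.
    move=> uT vT; have := flin (-1) v u vT uT.
    by rewrite scaleN1r mulN1r addrC [in RHS]addrC.
  have fD u v : u \in T -> v \in T -> f (u + v) = f u + f v.
    by move=> uT vT; have := flin 1 u v uT vT; rewrite scale1r mul1r.
  have hs : has_sup W.
    split; first by exists (f (ell_res set0 x) - f (ell_res set0 x)), set0, set0; rewrite setI0.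
    exists (C * `|x|) => _ [A [B [IA IB AB ->]]]; rewrite -fB ?xT//.
    have rT : ell_res A x - ell_res B x \in T.
      by rewrite addrC -scaleN1r rpredD ?rpredZ ?xT.
    rewrite (le_trans (ler_norm _))// (le_trans (fC _ rT))// ler_wpM2l//.
    apply: ell_norm_le => k.
    have -> : (ell_res A x - ell_res B x) k = (\1_A k - \1_B k) * x k by rewrite mulrBl.
    rewrite normrM ler_piMl// !indicE.
    by case: (k \in A); case: (k \in B); rewrite ?subrr ?subr0 ?sub0r ?normrN ?normr1 ?normr0.
  move=> e0; have [_ [A [B [IA IB AB ->]]] sup_lt] := sup_adherent e0 hs.
  exists (A `|` B) => [|D ID]; first exact: IU.
  rewrite setIUl setU_eq0 => -[AD BD].
  (* Adjoining [D] to [A] or to [B] changes the near-supremum by plus or minus [f (ell_res D x)];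
     neither change can gain [e]. *)
  have le1 : f (ell_res (A `|` D) x) - f (ell_res B x) <= sup W.
    apply: ub_le_sup; first by case: hs.
    exists (A `|` D), B; split => //; first exact: IU.
    by rewrite setIUl AB set0U setIC.
  have le2 : f (ell_res A x) - f (ell_res (B `|` D) x) <= sup W.
    apply: ub_le_sup; first by case: hs.
    exists A, (B `|` D); split => //; first exact: IU.
    by rewrite setIUr AB AD setU0.
  move: le1 le2; rewrite !ell_resU// !fD ?xT// ler_norml; lra.
have diff e : 0 < e -> exists2 A, I A & forall B, I B -> A `<=` B ->
    `|f (ell_res B x) - f (ell_res A x)| <= e.
  move=> /tail[A IA Ae]; exists A => // B IB AB.
  have ID : I (B `\` A) by apply: IS IB; exact: subDsetl.
  have AD : A `&` (B `\` A) = set0 by rewrite setDIK.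
  rewrite -[in X in f X - _](setDUK AB) ell_resU//.
  have := flin 1 _ _ (xT _ IA) (xT _ ID).
  by rewrite scale1r mul1r => ->; rewrite addrAC subrr add0r; exact: Ae.
(* The limit is taken as the lower limit of the net, the supremum of its eventual lower bounds; the
   Cauchy property [diff] keeps it within [e / 2] of the value at [A]. *)
pose V := [set t | exists2 A, I A &
  forall B, I B -> A `<=` B -> t <= f (ell_res B x)].
exists (sup V) => e e0; have e2 : 0 < e / 2 by rewrite divr_gt0.
have [A IA Ae] := diff _ e2; exists A => // B IB AB.
have Vub t : V t -> t <= f (ell_res A x) + e / 2.
  move=> [D ID tD]; have := tD (A `|` D) (IU _ _ IA ID) (@subsetUr _ _ _).
  have := Ae (A `|` D) (IU _ _ IA ID) (@subsetUl _ _ _).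
  by rewrite ler_norml; lra.
have VA : V (f (ell_res A x) - e / 2).
  by exists A => // D ID AD; have := Ae D ID AD; rewrite ler_norml; lra.
have le1 : sup V <= f (ell_res A x) + e / 2.
  by apply: ge_sup => //; exists (f (ell_res A x) - e / 2).
have le2 : f (ell_res A x) - e / 2 <= sup V.
  by apply: ub_le_sup => //; exists (f (ell_res A x) + e / 2).
by have := Ae B IB AB; rewrite !ler_norml; lra.
Qed.

(** * Regular functionals *)

Definition regular I (g : ell q -> R) :=
  forall x, lim_along I (fun A => g (ell_res A x)) (g x).

Lemma regular_comb I a (g h : dual (ell q)) : set_ideal I ->
  regular I g -> regular I h -> regular I (a *: g + h).
Proof. by move=> II rg rh x; exact: lim_along_comb (rg x) (rh x). Qed.

(** By continuity [g] vanishes on the closure of [S], so its values at the restrictions of [x] are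
    all 0, and [g x] is their limit. *)
Lemma regular_eq0 I (S : submodClosed (ell q)) (g : dual (ell q)) :
  set_ideal I -> (forall x A, I A -> ell_res A x \in closurep S) ->
  regular I g -> {in S, forall x, g x = 0} -> g = 0.
Proof.
move=> II IS rg gS; apply/val_inj/funext => x /=.
apply: (lim_along_unique II (rg x)); apply: (@lim_along_near_cst _ _ _ set0).
  by case: II.
by move=> A IA _; apply: dual_closurep0 gS _; exact: IS.
Qed.

(** The bounded extension to the closure of [S] is evaluated at restrictions of [x] and passed to
    the limit along [I]. If [x] is supported in a member of [I], the net is eventually constant,
    which gives both agreement on [S] and regularity. *)
Lemma regular_extension I (S : submodClosed (ell q)) (f : ell q -> R) C :
  set_ideal I -> (forall x A, I A -> ell_res A x \in closurep S) ->
  {in S, forall x, exists2 A, I A & ell_res A x = x} ->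
  0 <= C -> linear_on S f -> {in S, forall x, `|f x| <= C * `|x|} ->
  exists g : dual (ell q), [/\ regular I g, {in S, g =1 f} & `|g| <= C].
Proof.
move=> II IT IS C0 flin fC; have [I0 IU Isub] := II.
have [h [hlin hC hf]] := linear_on_closurep C0 flin fC.
have [g gP] := choice (fun x => lim_along_exists II C0 hlin hC (IT x)).
have glin : linear g.
  move=> a x y; apply: (lim_along_unique II (gP _)).
  have := lim_along_comb a II (gP x) (gP y) => l e e0.
  have [A IA Ae] := l e e0; exists A => // B IB AB.
  by rewrite ell_res_comb hlin ?IT//; exact: Ae.
have gC x : `|g x| <= C * `|x|.
  apply: (lim_along_le (gP x)) => A IA.
  by rewrite (le_trans (hC _ (IT _ _ IA)))// ler_wpM2l// ell_res_norm.
have gh A x : I A -> ell_res A x = x -> g x = h x.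
  move=> IA Ax; apply: (lim_along_unique II (gP x)).
  apply: (lim_along_near_cst IA) => B IB AB.
  by rewrite -Ax ell_res_subK.
have [d dg] := dual_of glin gC.
exists d; split; last by apply: dual_norm_le_ub => // x; rewrite dg.
  move=> x e e0; have [A IA Ae] := gP x e e0; exists A => // B IB AB.
  rewrite !dg (gh B (ell_res B x)) ?ell_res_subK//; exact: Ae.
by move=> s sS; have [A IA As] := IS s sS; rewrite dg (gh A)// hf.
Qed.

End restriction.

(** * Duality with the conjugate exponent *)

Section duality.
Context {R : realType}.

Lemma esum_nat_le (D : set nat) (a : nat -> R) M : (forall k, 0 <= a k) ->
  (\esum_(k in D) (a k)%:E <= M%:E)%E <->
  (forall n, \sum_(k < n | val k \in D) a k <= M).
Proof.
move=> a0.
have a0' k : k \in D -> (0 <= (a k)%:E)%E by rewrite lee_fin.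
have partE n : (\sum_(0 <= k < n | k \in D) (a k)%:E)%E =
    (\sum_(k < n | val k \in D) a k)%:E.
  by rewrite big_mkord sumEFin.
have -> : (\esum_(k in D) (a k)%:E = \sum_(0 <= k <oo | k \in D) (a k)%:E)%E.
  rewrite nneseries_esum//; congr esum.
  by apply/seteqP; split => k /=; rewrite inE.
split => [aM n|aM].
  rewrite -lee_fin -partE (le_trans _ aM)//.
  by apply: nneseries_lim_ge => k _; exact: a0'.
apply: lime_le; first by apply: is_cvg_nneseries => k _; exact: a0'.
by apply: nearW => n; rewrite partE lee_fin.
Qed.

Lemma ell_sumE (q : exponent R) n (F : 'I_n -> ell q) k :
  (\sum_i F i) k = \sum_i F i k.
Proof. by apply: (big_morph (fun x : ell q => x k)). Qed.

Lemma dual_sum (E : normedModType R) (f : dual E) n (F : 'I_n -> E) :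
  f (\sum_i F i) = \sum_i f (F i).
Proof. by apply: (big_morph f); [exact: dualD|exact: dual0]. Qed.

Variable p : finite_exponent R.

Lemma fexpo_gt0 k : 0 < p k.
Proof. by rewrite (lt_le_trans ltr01)// fexpo_ge1. Qed.

Lemma modular_finE (x : nat -> R) :
  modular p x = (\esum_(k in setT) (`|x k| `^ p k)%:E)%E.
Proof.
rewrite /modular (_ : (_ |` _) = [set 0%E]); last first.
  by apply/seteqP; split => [_ [->//|[k //]]|_ ->]; left.
rewrite ereal_sup1 adde0; congr esum.
by apply/seteqP; split.
Qed.

Lemma modular_fin_le (x : nat -> R) M :
  (modular p x <= M%:E)%E <-> (forall n, \sum_(k < n) `|x k| `^ p k <= M).
Proof.
rewrite modular_finE esum_nat_le; last by move=> k; exact: powR_ge0.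
have E n : \sum_(k < n | val k \in [set: nat]) `|x k| `^ p k =
    \sum_(k < n) `|x k| `^ p k by apply: eq_bigl => k; rewrite in_setT.
by split=> h n; have := h n; rewrite E.
Qed.

Lemma finite_content_finite (A : set nat) : finite_set A -> finite_content p A.
Proof.
move=> fA; exists 2; first by rewrite ltr1n.
rewrite esum_fset//.
by rewrite fsbig_finite//= sumEFin ltry.
Qed.

Definition delta_set k := ContentSet (finite_content_finite (finite_set1 k)).

(** As the indicator of a set of finite content, a unit vector is also a simple element, so all
    components of the decomposition can be evaluated on it. *)
Definition ell_delta k : ell p := ell_indic (delta_set k).

Lemma ell_deltaE j k : ell_delta j k = (k == j)%:R.
Proof.
rewrite [LHS]indicE; congr ((nat_of_bool _)%:R).
by apply/idP/eqP => [/set_mem//|->]; exact: mem_set.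
Qed.

Lemma sum_ell_deltaE n (c : nat -> R) k :
  (\sum_(i < n) c i *: ell_delta i) k = if (k < n)%N then c k else 0.
Proof.
rewrite ell_sumE; case: ltnP => kn.
  rewrite (bigD1 (Ordinal kn))//= big1 => [|i ik].
    by rewrite [X in X + _](_ : _ = c k * ell_delta k k)// ell_deltaE eqxx mulr1 addr0.
  rewrite [LHS](_ : _ = c i * ell_delta i k)// ell_deltaE.
  suff /negbTE -> : k != i by rewrite mulr0.
  by apply: contra ik => /eqP ki; apply/eqP/val_inj.
rewrite big1// => i _; rewrite [LHS](_ : _ = c i * ell_delta i k)// ell_deltaE.
by rewrite gtn_eqF ?mulr0// (leq_trans (ltn_ord i)).
Qed.

Lemma ell_delta_norm k : `|ell_delta k| <= 1.
Proof.
apply: ell_norm_le_adm => //; apply/modular_fin_le => n.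
rewrite (eq_bigr (fun i : 'I_n => (k == i)%:R)) => [|i _].
  case: (ltnP k n) => kn.
    rewrite (bigD1 (Ordinal kn))//= eqxx big1 ?addr0// => i ik.
    have /negbTE -> // : k != i.
    by apply: contra ik => /eqP ki; apply/eqP/val_inj.
  by rewrite big1 ?ler01// => i _; rewrite gtn_eqF// (leq_trans (ltn_ord i)).
rewrite divr1 ell_deltaE eq_sym; case: (k == i); first by rewrite normr1 powR1.
by rewrite normr0 powR0// gt_eqF// fexpo_gt0.
Qed.

(** * Hoelder's inequality and its converse *)

Lemma dual_expoP k : expo (dual_exponent p) k != +oo%E ->
  exists r, [/\ expo (dual_exponent p) k = r%:E, 0 < r, (p k)^-1 <= 1, r^-1 <= 1 &
    (p k)^-1 + r^-1 = 1].
Proof.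
have := dual_exponentP p k; have := expo_ge1 (dual_exponent p) k.
case: (expo (dual_exponent p) k) => // r; rewrite lee_fin => r1 pr _.
have r0 : 0 < r by rewrite (lt_le_trans ltr01).
exists r; split => //; rewrite ?invf_le1 ?fexpo_ge1 ?fexpo_gt0//.
move: pr; rewrite /= !inver !gt_eqF ?fexpo_gt0//.
by rewrite -EFinD => -[].
Qed.

Lemma dual_expo_eqy k : expo (dual_exponent p) k = +oo%E -> p k = 1.
Proof. by move=> /hoelder_conjugate_eqy[]. Qed.

(** Young's inequality applies where the conjugate exponent is finite; elsewhere [p k = 1] and [v k]
    has modulus at most 1. Each modular contributes at most 1, whence the 2. *)
Lemma young_modular (u v : nat -> R) n :
  (modular p u <= 1)%E -> (modular (dual_exponent p) v <= 1)%E ->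
  \sum_(k < n) `|u k * v k| <= 2.
Proof.
move=> u1 v1; pose D := [set k | expo (dual_exponent p) k != +oo%E].
have := u1; rewrite (modular_fin_le _ 1) => /(_ n) un.
pose a k := `|v k| `^ fine (expo (dual_exponent p) k).
have vn : \sum_(k < n | val k \in D) a k <= 1.
  move: n {un}; apply: (@esum_nat_le D a 1 _).1; first by move=> k; exact: powR_ge0.
  apply: le_trans v1; rewrite /modular leeDl//.
  by apply: ereal_sup_ubound; left.
have uv k : `|u k * v k| <= `|u k| `^ p k + (if k \in D then a k else 0).
  rewrite normrM; case: ifPn => kD.
    have /dual_expoP[r [er r0 p1 r1 pr]] := set_mem kD.
    rewrite /a er (le_trans (conjugate_powR _ _ (fexpo_gt0 k) r0 pr))//= lerD//.
      by rewrite ler_piMr// powR_ge0.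
    by rewrite ler_piMr// powR_ge0.
  have /dual_expo_eqy -> : expo (dual_exponent p) k = +oo%E.
    by apply/eqP; apply: contraNT kD => kD; exact: mem_set.
  by rewrite addr0 powRr1// ler_piMr//; exact: modular_le1 v1.
apply: le_trans (lerD un vn); rewrite [X in _ <= _ + X]big_mkcond -big_split.
by apply: ler_sum => k _; exact: uv.
Qed.

Lemma hoelder_ell (x : ell p) (y : ell (dual_exponent p)) n :
  \sum_(k < n) `|x k * y k| <= 2 * `|x| * `|y|.
Proof.
suff h l m : `|x| < l -> `|y| < m -> \sum_(k < n) `|x k * y k| <= 2 * l * m.
  apply/ler_addgt0Pr => e e0.
  (* With [d <= 1] the excess 2 d (|x| + |y| + d) is at most [e]. *)
  pose d := Num.min 1 (e / (2 * (`|x| + `|y| + 1))).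
  have s0 : 0 < 2 * (`|x| + `|y| + 1) by rewrite mulr_gt0// ltr_wpDl// addr_ge0.
  have d0 : 0 < d by rewrite lt_min ltr01 divr_gt0.
  have d1 : d <= 1 by rewrite ge_min lexx.
  have de : d * (2 * (`|x| + `|y| + 1)) <= e.
    by rewrite -ler_pdivlMr// ge_min lexx orbT.
  have := h (`|x| + d) (`|y| + d); rewrite !ltrDl => /(_ d0 d0).
  have := normr_ge0 x; have := normr_ge0 y; nra.
move=> xl ym; have l0 : 0 < l by rewrite (le_lt_trans _ xl).
have m0 : 0 < m by rewrite (le_lt_trans _ ym).
have := young_modular n (ell_adm_norm_lt xl) (ell_adm_norm_lt ym).
rewrite -mulrA -ler_pdivrMr ?mulr_gt0// mulr_suml.
under eq_bigr do rewrite mulrACA normrM -invfM (gtr0_norm (_ : 0 < (l * m)^-1))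
  ?invr_gt0 ?mulr_gt0//.
by [].
Qed.

(* Test [f] on the extremal sequence [sg (v k) * `|v k| `^ (p' k - 1)] of
   Hoelder's inequality; the factor [2] makes the estimate strict. *)
Lemma dual_modular_delta (f : dual (ell p)) l : 0 < l -> `|f| <= l ->
  (modular (dual_exponent p) (fun k => f (ell_delta k) / (2 * l))%R <= 1)%E.
Proof.
move=> l0 fl; set v := fun k => _.
pose D := [set k | expo (dual_exponent p) k != +oo%E].
pose r k := fine (expo (dual_exponent p) k).
have v2 k : `|v k| <= 2^-1.
  rewrite normrM normfV (gtr0_norm (_ : 0 < 2 * l)) ?mulr_gt0// ler_pdivrMr ?mulr_gt0//.
  rewrite mulKf// (le_trans (dual_ub _ _))// (le_trans _ fl)// ler_piMr//.
  exact: ell_delta_norm.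
(* The bound 1 is shared equally between the sum and the supremum. *)
rewrite /modular [leRHS](_ : _ = 2^-1%:E + 2^-1%:E)%E; last first.
  by rewrite -EFinD; congr EFin; lra.
apply: leeD; last first.
  apply: ge_ereal_sup => _ [->|[k _ <-]]; first by rewrite lee_fin invr_ge0.
  by rewrite lee_fin.
apply/esum_nat_le => [k|n]; first exact: powR_ge0.
set T := \sum_(k < n | _) _.
pose b k := if k \in D then `|v k| `^ r k else 0.
have b0 k : 0 <= b k by rewrite /b; case: ifP => // _; exact: powR_ge0.
have TE : T = \sum_(k < n) b k by rewrite [LHS]big_mkcond.
pose c k := if k \in D then Num.sg (v k) * `|v k| `^ (r k - 1) else 0.
pose x := \sum_(k < n) c k *: ell_delta k.
have cp k : `|c k| `^ p k = b k.
  rewrite /b /c; case: ifPn => [kD|_]; last first.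
    by rewrite normr0 powR0// gt_eqF// fexpo_gt0.
  have /dual_expoP[s [rs s0 p1 s1 ps]] := set_mem kD.
  have {}rs : r k = s by rewrite /r rs.
  have [->|v0] := eqVneq (v k) 0.
    by rewrite sgr0 mul0r !normr0 !powR0// ?rs gt_eqF// fexpo_gt0.
  rewrite normrM normr_sg v0 mul1r ger0_norm ?powR_ge0// -powRrM; congr powR.
  (* Conjugacy of the exponents gives [(s - 1) * p k = s]. *)
  rewrite rs; have := fexpo_gt0 k; move: (p k) ps => t ps t0.
  have : t * s * (t^-1 + s^-1) = t * s by rewrite ps mulr1.
  rewrite mulrDr -[t * s / s]mulrA divff ?gt_eqF// mulr1 [t * s]mulrC -mulrA divff ?gt_eqF//.
  lra.
have cv k : c k * f (ell_delta k) = 2 * l * b k.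
  have fv : f (ell_delta k) = 2 * l * v k.
    by rewrite mulrC /v divfK// gt_eqF// mulr_gt0.
  rewrite fv mulrCA; congr (_ * _).
  rewrite /b /c; case: ifPn => [kD|_]; last by rewrite mul0r.
  have /dual_expoP[s [rs s0 _ _ _]] := set_mem kD.
  have {}rs : r k = s by rewrite /r rs.
  by rewrite mulrAC -normrEsg mulr_powRB1// rs.
have fx : f x = 2 * l * T.
  rewrite dual_sum (eq_bigr (fun k : 'I_n => c k * f (ell_delta k))) => [|k _];
    last exact: dualZ.
  rewrite TE mulr_sumr; apply: eq_bigr => k _; exact: cv.
have T0 : 0 <= T by apply: sumr_ge0 => k _; exact: powR_ge0.
(* Dividing [x] by [m >= 1] divides its modular, at most [T], by at least [m]; hence the norm of [x]
   is at most [m]. *)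
pose m := Num.max T 1; have m0 : 0 < m by rewrite lt_max ltr01 orbT.
have xT : (modular p x <= T%:E)%E.
  apply/modular_fin_le => N.
  have xk k : `|x k| `^ p k = if (k < n)%N then b k else 0.
    rewrite sum_ell_deltaE; case: ltnP => _ /=; first exact: cp.
    by rewrite normr0 powR0// gt_eqF// fexpo_gt0.
  rewrite (eq_bigr (fun k : 'I_N => if (k < n)%N then b k else 0)); last first.
    by move=> k _; exact: xk.
  rewrite TE; case: (leqP n N) => nN; first by rewrite (big_ord_widen N b nN) [leRHS]big_mkcond.
  rewrite (big_ord_widen n (fun k => if (k < n)%N then b k else 0) (ltnW nN)) big_mkcond/=.
  by apply: ler_sum => k _; rewrite ltn_ord; case: ifP.
have xm : `|x| <= m.
  apply: ell_norm_le_adm => //.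
  rewrite (_ : (fun k => x k / m) = fun k => m^-1 * x k); last first.
    by apply/funext => k; rewrite mulrC.
  have m1 : 0 <= m^-1 <= 1.
    by rewrite invr_ge0 ltW//= invf_le1// le_max lexx orbT.
  rewrite (le_trans (modular_scale _ _ m1))// (@le_trans _ _ (m^-1%:E * T%:E)%E)//.
    by rewrite lee_wpmul2l// lee_fin invr_ge0 ltW.
  by rewrite -EFinM lee_fin mulrC ler_pdivrMr// mul1r le_max lexx.
(* After division by [l] this reads 2 T <= max(T, 1), which leaves only T <= 1/2. *)
have : 2 * l * T <= l * m.
  rewrite -fx (le_trans (ler_norm _))// (le_trans (dual_ub _ _))//.
  by rewrite ler_pM.
rewrite [2 * l]mulrC -mulrA ler_pM2l// /m; case: (leP T 1) => T1; lra.
Qed.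

Lemma dual_delta_ell (f : dual (ell p)) : exists2 y : ell (dual_exponent p),
  (forall k, y k = f (ell_delta k)) & `|y| <= 2 * `|f|.
Proof.
have yP : (fun k => f (ell_delta k)) \in ellp (dual_exponent p).
  have f1 : 0 < `|f| + 1 by rewrite ltr_wpDl.
  apply/asboolP; exists (2 * (`|f| + 1)); first by rewrite mulr_gt0.
  apply: le_lt_trans (ltry 1); apply: dual_modular_delta => //.
  by rewrite lerDl.
exists (Ell yP) => //; apply/ler_addgt0Pr => e e0.
have -> : 2 * `|f| + e = 2 * (`|f| + e / 2) by lra.
have fe : 0 < `|f| + e / 2 by rewrite ltr_wpDl// divr_gt0.
apply: ell_norm_le_adm; first by rewrite mulr_gt0.
by apply: dual_modular_delta => //; rewrite lerDl divr_ge0// ltW.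
Qed.

End duality.

(** * Dense subspaces *)

Section density.
Context {R : realType}.

Lemma mem_closurep (E : normedModType R) (S : submodClosed E) x :
  x \in S -> x \in closurep S.
Proof.
by move=> Sx; apply/closurepP => e e0; exists x => //; rewrite subrr normr0.
Qed.

(** Vanishing on [S], hence on its closure, makes the value of [d] independent of the
    representative; representatives of almost minimal norm give the bound. *)
Lemma dual_quot (E : normedModType R) (S : submodClosed E) (d : dual E) :
  {in S, forall x, d x = 0} -> exists2 h : dual (quot_closure S),
    (forall x, h (\pi_(quot_closure S) x) = d x) & `|h| <= `|d|.
Proof.
move=> dS; pose h (v : quot_closure S) := d (repr v).
have hE x : h (\pi_(quot_closure S) x) = d x.
  apply/eqP; rewrite -subr_eq0 -dualB; apply/eqP/(dual_closurep0 dS).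
  by apply/quot_piP; rewrite reprK.
have hlin : linear h.
  move=> a u v; rewrite -[u]reprK -[v]reprK [a *: _]quot_pi_scale -quot_piD !hE.
  exact: dual_lin.
have hC v : `|h v| <= `|d| * `|v|.
  apply/ler_addgt0Pr => e e0.
  have d1 : 0 < `|d| + 1 by rewrite ltr_wpDl.
  have ve : quot_norm v < quot_norm v + e / (`|d| + 1) by rewrite ltrDl divr_gt0.
  have [x <- xe] := quot_norm_lt ve; rewrite hE (le_trans (dual_ub _ _))//.
  rewrite (le_trans (ler_wpM2l _ (ltW xe)))// mulrDr lerD2l.
  by rewrite mulrCA ler_piMr ?(ltW e0)// ler_pdivrMr// mul1r lerDl.
have [k kh] := dual_of hlin hC.
exists k; first by move=> x; rewrite kh hE.
by apply: dual_norm_le_ub => // v; rewrite kh.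
Qed.

Lemma sum_tail (a : nat -> R) C : (forall k, 0 <= a k) ->
  (forall n, \sum_(k < n) a k <= C) ->
  forall e, 0 < e -> exists n, forall m, \sum_(k < m | (n <= k)%N) a k <= e.
Proof.
move=> a0 aC e e0; pose V := [set \sum_(k < n) a k | n in setT].
have hs : has_sup V.
  by split; [exists (\sum_(k < 0) a k), 0%N|exists C => _ [n _ <-]].
have [_ [n _ <-] ne] := sup_adherent e0 hs; exists n => m.
case: (leqP n m) => nm; last first.
  by rewrite big1 ?(ltW e0)// => k /leq_trans/(_ (ltnW (ltn_ord k))); rewrite leqNgt nm.
have : \sum_(k < m) a k <= sup V by apply: ub_le_sup; [case: hs|exists m].
rewrite (bigID (fun k : 'I_m => (k < n)%N))/= -(big_ord_widen m a nm).
rewrite (eq_bigl (fun k : 'I_m => (n <= k)%N)) => [|k]; last by rewrite -leqNgt.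
lra.
Qed.

Variable p : finite_exponent R.

(** * Finitely supported elements *)

Definition finsupp : {pred ell p} :=
  fun x => `[< exists n, forall k, (n <= k)%N -> x k = 0 >].

Lemma finsupp_submod_closed : submod_closed finsupp.
Proof.
split; first by apply/asboolP; exists 0%N.
move=> a x y /asboolP[n xn] /asboolP[m ym]; apply/asboolP; exists (maxn n m) => k.
by rewrite geq_max => /andP[nk mk]; rewrite ell_linearE xn// ym// mulr0 addr0.
Qed.

HB.instance Definition _ :=
  GRing.isSubmodClosed.Build R (ell p) finsupp finsupp_submod_closed.

Lemma finsupp_sum (x : ell p) n : (forall k, (n <= k)%N -> x k = 0) ->
  x = \sum_(k < n) x k *: ell_delta p k.
Proof.
move=> xn; apply: ell_ext => k; rewrite sum_ell_deltaE.
by case: ltnP => // /xn.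
Qed.

Lemma ell_delta_finsupp k : ell_delta p k \in finsupp.
Proof.
by apply/asboolP; exists k.+1 => j kj; rewrite ell_deltaE gtn_eqF.
Qed.

Lemma dual_finsupp0 (g : dual (ell p)) :
  (forall k, g (ell_delta p k) = 0) -> {in finsupp, forall x, g x = 0}.
Proof.
move=> g0 x /asboolP[n xn]; rewrite (finsupp_sum xn) dual_sum big1// => k _.
by rewrite dualZ g0 mulr0.
Qed.

Lemma finite_set_ideal : set_ideal (@finite_set nat).
Proof.
split=> //; first by move=> A B fA fB; rewrite finite_setU.
by move=> A B AB; exact: sub_finite_set.
Qed.

Lemma ell_res_finsupp A (x : ell p) : finite_set A -> ell_res A x \in finsupp.
Proof.
move=> /finite_seqP[s ->]; apply/asboolP; exists (\max_(i <- s) i).+1 => k sk.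
rewrite ell_resE indicE memNset ?mul0r//= => ks.
by move: sk; rewrite ltnNge leq_bigmax_seq.
Qed.

Lemma finsupp_ell_res : {in finsupp, forall x : ell p,
  exists2 A, finite_set A & ell_res A x = x}.
Proof.
move=> x /asboolP[n xn]; exists `I_n => //; apply: ell_ext => k.
rewrite ell_resE indicE; have [kn|kn] := boolP (k \in _); first by rewrite mul1r.
rewrite mul0r xn// leqNgt; apply: contra kn => kn; exact: mem_set.
Qed.

(** Where [p] is at most [M], a factor [c >= 1] enlarges the modular at most [c ^ M] times. A tail
    of small modular therefore has small norm. *)
Lemma ellb_closurep_finsupp : {subset ellb p <= closurep finsupp}.
Proof.
move=> x /asboolP[M xM]; apply/closurepP => e e0.
pose d := e / 2; have d0 : 0 < d by rewrite divr_gt0.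
pose l := `|x| + 1; have l0 : 0 < l by rewrite ltr_wpDl.
have xl : (modular p (fun k => x k / l)%R <= 1)%E.
  by apply: ell_adm_norm_lt; rewrite ltrDl.
(* [c] covers the change of scale from [l] to [d]; the maximum with 1 makes [c ^ p k <= c ^ M]. *)
pose c := Num.max 1 (l / d); have c1 : 1 <= c by rewrite le_max lexx.
have c0 : 0 < c by rewrite (lt_le_trans ltr01).
have cM0 : 0 < c `^ M by rewrite powR_gt0.
have cMV0 : 0 < (c `^ M)^-1 by rewrite invr_gt0.
pose a k := `|x k / l| `^ p k; have a0 k : 0 <= a k by exact: powR_ge0.
have [n na] := sum_tail a0 ((modular_fin_le _ _ 1).1 xl) cMV0.
exists (ell_res `I_n x).
  by apply: ell_res_finsupp; exact: finite_II.
rewrite (@le_lt_trans _ _ d)//; last by rewrite /d; lra.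
have zk k : (x - ell_res `I_n x) k = if (k < n)%N then 0 else x k.
  rewrite [LHS](_ : _ = x k - \1_(`I_n) k * x k)// indicE.
  have -> : (k \in `I_n) = (k < n)%N by apply/idP/idP => [/set_mem|/mem_set].
  by case: ltnP => _; rewrite ?mul1r ?subrr// mul0r subr0.
apply: ell_norm_le_adm => //; apply/modular_fin_le => m.
apply: (@le_trans _ _ (c `^ M * \sum_(k < m | (n <= k)%N) a k)); last first.
  by rewrite mulrC -ler_pdivlMr// mul1r.
rewrite mulr_sumr [leRHS]big_mkcond; apply: ler_sum => k _.
cbv beta; rewrite zk; case: ltnP => nk.
  by rewrite mul0r normr0 powR0// gt_eqF// fexpo_gt0.
have [xk|xk] := eqVneq (x k) 0.
  by rewrite xk mul0r normr0 powR0 ?mulr_ge0 ?powR_ge0// gt_eqF// fexpo_gt0.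
apply: (@le_trans _ _ (c `^ p k * a k)); last first.
  by rewrite ler_wpM2r// ler_powR// xM.
rewrite -powRM ?(ltW c0)// ge0_ler_powR ?nnegrE ?mulr_ge0 ?(ltW (fexpo_gt0 _ _)) ?(ltW c0)//.
rewrite !normrM !normfV (gtr0_norm d0) (gtr0_norm l0) mulrCA ler_wpM2l//.
rewrite -ler_pdivrMr ?invr_gt0// invrK mulrC.
by rewrite /c le_max lexx orbT.
Qed.

(** By density of finite supports in [ellb], a functional that kills the unit vectors factors
    through the germ space. *)
Lemma dual_ellb0 (g : dual (ell p)) : (forall k, g (ell_delta p k) = 0) ->
  {in closurep (ellb p), forall x, g x = 0}.
Proof.
move=> g0 x; apply: dual_closurep0 => s /ellb_closurep_finsupp.
by apply: dual_closurep0; exact: dual_finsupp0.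
Qed.

(** * Simple elements *)

Lemma finite_content_ideal : set_ideal (finite_content p).
Proof.
split; first exact: finite_content_finite.
- exact: finite_contentU.
- exact: finite_content_sub.
Qed.

Lemma ell_simple_indic (A : content_set p) : ell_indic A \in ell_simple p.
Proof.
apply/asboolP; exists 1%N, (fun=> 1), (fun=> A); split.
  by move=> i j _ _ _; rewrite (ord1 i) (ord1 j).
by rewrite big_ord1 scale1r.
Qed.

Lemma ell_simple_ell_res : {in ell_simple p, forall x,
  exists2 A, finite_content p A & ell_res A x = x}.
Proof.
move=> x /ell_simpleP[_ xc]; exists [set k | x k != 0] => //.
apply: ell_ext => k; rewrite ell_resE indicE.
have [->|xk] := eqVneq (x k) 0; first by rewrite mulr0.
by rewrite mem_set// mul1r.
Qed.

(** Elements of the space are bounded, so on [A] rounding to finitely many values is possible with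
    uniform error [d]. The error is dominated by [d] times the indicator of [A], which is in the
    space because [A] has finite content. *)
Lemma ell_res_simple A (x : ell p) : finite_content p A ->
  ell_res A x \in closurep (ell_simple p).
Proof.
move=> cA; pose I := ell_indic (ContentSet cA); apply/closurepP => e e0.
pose b := `|x| + 1; have b0 : 0 < b by rewrite ltr_wpDl.
have xb k : `|x k| <= b.
  have /ell_adm_norm_lt/(modular_le1 k) : `|x| < b by rewrite ltrDl.
  by rewrite normrM normfV (gtr0_norm b0) ler_pdivrMr// mul1r.
pose d := e / (`|I| + 1); have I0 : 0 < `|I| + 1 by rewrite ltr_wpDl.
have d0 : 0 < d by rewrite divr_gt0.
have dI k : (d *: I) k = d * \1_A k by [].
(* The shift by [b] makes the argument nonnegative, so that truncation to a natural number rounds it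
   down. *)
pose t k := Num.truncn ((x k + b) / d).
have xb0 k : 0 <= (x k + b) / d.
  by rewrite divr_ge0 ?(ltW d0)//; have := xb k; rewrite ler_norml; lra.
have td k : (t k)%:R * d <= x k + b < (t k)%:R * d + d.
  have := truncn_itv (xb0 k); rewrite ler_pdivlMr// ltr_pdivrMr//.
  by rewrite -natr1 (mulrDl _ 1) mul1r.
have dP : (fun k => \1_A k * (x k + b - (t k)%:R * d)) \in ellp p.
  apply: ellp_le (ell_seqP (d *: I)) => k.
  rewrite dI normrM [leRHS]normrM [leRHS]mulrC ler_wpM2l//.
  by have := td k; rewrite (gtr0_norm d0) ler_norml; lra.
pose D : ell p := Ell dP; pose s : ell p := ell_res A x - D; exists s.
  have sk k : s k = \1_A k * ((t k)%:R * d - b).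
    by rewrite [LHS](_ : _ = \1_A k * x k - \1_A k * (x k + b - (t k)%:R * d))//; lra.
  apply/ell_simpleP; split; last first.
    apply: finite_content_sub (cA) => k s0; have : s k != 0 := s0; rewrite sk indicE.
    by have [/set_mem//|_] := boolP (k \in A); rewrite mul0r eqxx.
  (* Since [x k + b] lies between 0 and [2 * b], only levels below [N] occur. *)
  pose N := (Num.truncn (2 * b / d)).+1.
  apply: (@sub_finite_set _ _ (0 |` [set n%:R * d - b | n in `I_N])); last first.
    by rewrite finite_setU; split => //; apply: finite_image; exact: finite_II.
  move=> _ [k _ <-]; rewrite sk indicE; have [kA|_] := boolP (k \in A); last first.
    by left; rewrite mul0r.
  right; exists (t k); last by rewrite mul1r.
  rewrite /= ltnS le_truncn// ler_pM2r ?invr_gt0//.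
  by have := xb k; rewrite ler_norml; lra.
rewrite /s opprB addrC subrK; apply: (@le_lt_trans _ _ (d * `|I|)).
  rewrite -(gtr0_norm d0) -normrZ; apply: ell_norm_le => k.
  rewrite dI normrM [leRHS]normrM [leRHS]mulrC ler_wpM2l//.
  by have := td k; rewrite (gtr0_norm d0) ler_norml; lra.
rewrite /d -mulrA gtr_pMr// mulrC ltr_pdivrMr// mul1r.
by rewrite ltrDl.
Qed.

End density.
Arguments finsupp {R} p _.

(** * Set functions on sets of finite content *)

Section content_measures.
Context {R : realType} (p : finite_exponent R).
Implicit Types (A B D : content_set p) (mu : content_set p -> R).

(** Some [y] in [ellb] is closer than [l] to the indicator. Where [y] vanishes, the indicator equals
    the difference and so has modular at most 1 at scale [l]; cutting off an initial segment brings
    this down to [e]. What is removed lies in the support of [y] or in a finite set, where [p] is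
    bounded. *)
Lemma omega_lt A l e : omega A < l -> 0 < e ->
  exists2 D : set nat, ell_res (~` D) (ell_indic A) \in ellb p &
    forall n, \sum_(k < n) `|ell_res D (ell_indic A) k / l| `^ p k <= e.
Proof.
move=> Al e0; have l0 : 0 < l by rewrite (le_lt_trans _ Al)// normr_ge0.
have [x xA xl] := quot_norm_lt Al.
have : ell_indic A - x \in closurep (ellb p) by apply/quot_piP; rewrite xA.
move=> /closurepP/(_ (l - `|x|)); rewrite subr_gt0 => /(_ xl)[y yb yl].
have {yl}/ell_adm_norm_lt : `|ell_indic A - y| < l.
  rewrite (_ : ell_indic A - y = (ell_indic A - x - y) + x); last by rewrite addrAC subrK.
  by rewrite (le_lt_trans (ler_normD _ _))// -ltrBrDr.
move=> /(modular_fin_le _ _ 1).1 yl; move: yb => /asboolP[M yM].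
pose Z := [set k | y k = 0].
pose a k := `|ell_res Z (ell_indic A) k / l| `^ p k.
have a0 k : 0 <= a k by exact: powR_ge0.
have pk := fexpo_gt0 p.
have aC n : \sum_(k < n) a k <= 1.
  apply: le_trans (yl n); apply: ler_sum => k _; cbv beta.
  have dk : (ell_indic A - y) k = ell_indic A k - y k by [].
  rewrite dk /a ell_resE indicE; have [kZ|_] := boolP (_ \in Z).
    have -> : y k = 0 := set_mem kZ.
    by rewrite mul1r subr0.
  by rewrite mul0r mul0r normr0 powR0 ?powR_ge0// gt_eqF.
have [N NP] := sum_tail a0 aC e0.
exists (Z `&` [set k | (N <= k)%N]).
  (* The sum bounds [p] on the initial segment; the absolute value is taken because [M] may be
     negative. *)
  apply/asboolP; exists (`|M| + \sum_(j < N) p j) => k.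
  rewrite ell_resE indicE; have [kD _|_] := boolP (k \in _); last by rewrite mul0r eqxx.
  have S0 : 0 <= \sum_(j < N) p j by apply: sumr_ge0 => j _; exact: ltW.
  have := set_mem kD; rewrite setCI => -[yk|/negP].
    by rewrite (le_trans (yM k _))//; [apply/eqP|rewrite (le_trans (ler_norm _))// lerDl].
  rewrite /= -ltnNge => kN; rewrite (le_trans (_ : _ <= \sum_(j < N) p j))// ?lerDr//.
  by rewrite (bigD1 (Ordinal kN))//= lerDl sumr_ge0// => j _; exact: ltW.
move=> n; apply: le_trans (NP n); rewrite [leRHS]big_mkcond; apply: ler_sum => k _.
rewrite /a !ell_resE !indicE in_setI.
have -> : (val k \in [set k | (N <= k)%N]) = (N <= k)%N.
  by apply/idP/idP => [/set_mem|/mem_set].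
case: leqP => _; first by rewrite andbT.
by rewrite andbF !mul0r normr0 powR0// gt_eqF.
Qed.

Lemma ell_indicE A k : ell_indic A k = \1_A k.
Proof. by []. Qed.

Lemma ell_res_setC (q : exponent R) (D : set nat) (x : ell q) :
  ell_res D x = x - ell_res (~` D) x.
Proof.
have := ell_resU x (setICr D); rewrite setUCr => e; apply/eqP.
rewrite eq_sym subr_eq -e; apply/eqP/ell_ext => k.
by rewrite ell_resE indicT mul1r.
Qed.

(* Since [g] ignores [ellb], each [A i] can be cut down to where its indicator
   scaled by [l i] has modular at most [1 / n]; the sum then stays in the unit
   ball. *)
Lemma sum_dual_indic (g : dual (ell p)) n (A : 'I_n -> content_set p) (l : 'I_n -> R) :
  {in ellb p, forall x, g x = 0} -> trivIset setT A ->
  (forall i, omega (A i) < l i) ->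
  \sum_(i < n) `|g (ell_indic (A i))| / l i <= `|g|.
Proof.
(* With [n.+1] the share of each set is positive for [n = 0] too. *)
move=> gb tA Al; have n0 : 0 < (n.+1%:R^-1 : R) by rewrite invr_gt0.
have l0 i : 0 < l i by rewrite (le_lt_trans _ (Al i))// normr_ge0.
have hD i : exists D : set nat, ell_res (~` D) (ell_indic (A i)) \in ellb p /\
    forall m, \sum_(k < m) `|ell_res D (ell_indic (A i)) k / l i| `^ p k <= n.+1%:R^-1.
  by have [D Db Dm] := omega_lt (Al i) n0; exists D.
have [D DP] := choice hD.
have [u uE] : exists u : 'I_n -> ell p, forall i, u i = ell_res (D i) (ell_indic (A i)).
  by exists (fun i => ell_res (D i) (ell_indic (A i))).
have gu i : g (u i) = g (ell_indic (A i)).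
  by rewrite uE ell_res_setC dualB (gb _ (DP i).1) subr0.
pose c i := Num.sg (g (ell_indic (A i))) / l i.
pose x : ell p := \sum_i c i *: u i.
have gx : g x = \sum_(i < n) `|g (ell_indic (A i))| / l i.
  rewrite dual_sum; apply: eq_bigr => i _.
  by rewrite dualZ gu /c mulrAC mulrC normrEsg mulrC.
have xk k : x k = \sum_i c i * u i k by rewrite ell_sumE.
have u0 i k : ~ content_val (A i) k -> u i k = 0.
  by move=> Aik; rewrite uE ell_resE ell_indicE [\1_(A i) k]indicE memNset// mulr0.
have x1 : `|x| <= 1.
  apply: ell_norm_le_adm => //; apply/modular_fin_le => m.
  (* By disjointness each coordinate meets at most one piece, so the modular of [x] is at most the
     sum of the modulars of the pieces. *)
  apply: (@le_trans _ _ (\sum_(k < m) \sum_i `|u i k / l i| `^ p k)).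
    apply: ler_sum => k _; cbv beta; rewrite divr1 xk.
    have S0 i : 0 <= `|u i k / l i| `^ p k by exact: powR_ge0.
    have [[i Aik]|Ak] := pselect (exists i, content_val (A i) k).
      rewrite (bigD1 i)//= big1 => [|j ji]; last first.
        rewrite u0 ?mulr0// => Ajk; move/eqP: ji; apply.
        by apply: tA => //; exists k.
      rewrite addr0 [leRHS](bigD1 i)//= (le_trans (_ : _ <= `|u i k / l i| `^ p k))//.
        rewrite ge0_ler_powR ?nnegrE ?(ltW (fexpo_gt0 _ _))// /c.
        rewrite mulrAC [in leLHS]normrM [leRHS]normrM ler_wpM2r//.
        by rewrite normrM ler_piMl// normr_sg lern1 leq_b1.
      by rewrite lerDl sumr_ge0.
    rewrite big1 => [|i _]; first by rewrite normr0 powR0 ?sumr_ge0// gt_eqF// fexpo_gt0.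
    by rewrite u0 ?mulr0// => Aik; apply: Ak; exists i.
  rewrite exchange_big/= (le_trans (_ : _ <= \sum_(i < n) n.+1%:R^-1))//.
    by apply: ler_sum => i _; rewrite uE; exact: (DP i).2.
  by rewrite sumr_const card_ord -[_ *+ n]mulr_natl ler_pdivrMr// mul1r ler_nat.
rewrite -gx (le_trans (ler_norm _))// (le_trans (dual_ub _ _))//.
by rewrite ler_piMr.
Qed.

Lemma content_setU_indic A B : A `&` B = set0 ->
  ell_indic (content_setU A B) = ell_indic A + ell_indic B.
Proof.
move=> AB; apply: ell_ext => k.
rewrite [RHS](_ : _ = \1_A k + \1_B k)// ell_indicE !indicE in_setU.
have : ~~ ((k \in content_val A) && (k \in content_val B)) by rewrite -in_setI AB in_set0.
by case: (_ \in _); case: (_ \in _) => //=; rewrite ?addr0 ?add0r.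
Qed.

(** The variation is bounded by [sum_dual_indic] with [l i] just above [omega (A i)], the excess
    being sent to 0. *)
Lemma dual_pba (g : dual (ell p)) : {in ellb p, forall x, g x = 0} ->
  exists2 mu : pba p, (forall A, mu A = g (ell_indic A)) & `|mu| <= `|g|.
Proof.
move=> gb; pose m A := g (ell_indic A).
have om0 A : 0 <= omega A by exact: normr_ge0.
(* Every [e > 0] is allowed as [l] here, which squeezes [m A] to 0. *)
have m0 A : omega A = 0 -> m A = 0.
  move=> A0; apply: (@normr_eps0 R R^o _ `|g|) => e e0.
  have := @sum_dual_indic g 1 (fun=> A) (fun=> e) gb.
  rewrite big_ord1 ler_pdivrMr//; apply; last by rewrite A0.
  by move=> i j _ _ _; rewrite (ord1 i) (ord1 j).
have mb C : `|g| <= C -> omega_bounded m C.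
  move=> gC n A tA.
  rewrite (eq_bigr (fun i => (`|m (A i)| / omega (A i))%:E)) => [|i _]; last first.
    rewrite inver; case: eqVneq => [A0|//].
    by rewrite m0// normr0 mul0e mul0r.
  rewrite sumEFin lee_fin (le_trans _ gC)//; apply/ler_addgt0Pr => e e0.
  pose d := e / (`|g| + 1); have g1 : 0 < `|g| + 1 by rewrite ltr_wpDl.
  have d0 : 0 < d by rewrite divr_gt0.
  (* Null sets contribute nothing, so any positive value serves for them. *)
  pose l i := if omega (A i) == 0 then 1 else (1 + d) * omega (A i).
  have Al i : omega (A i) < l i.
    rewrite /l; case: eqVneq => [->//|A0].
    by rewrite ltr_pMl ?ltrDl// lt_neqAle eq_sym A0 om0.
  have := sum_dual_indic gb tA Al.
  have -> : \sum_i `|g (ell_indic (A i))| / l i =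
      (1 + d)^-1 * \sum_(i < n) `|m (A i)| / omega (A i).
    rewrite mulr_sumr; apply: eq_bigr => i _; rewrite /l -/(m _).
    case: eqVneq => [A0|A0]; first by rewrite m0// normr0 !mul0r mulr0.
    by rewrite invfM mulrCA.
  have d1 : 0 < 1 + d by rewrite addr_gt0.
  rewrite ler_pdivrMl// => /le_trans; apply.
  rewrite mulrDl mul1r lerD2l /d mulrAC ler_pdivrMr// mulrDr.
  by rewrite mulr1 lerDl ltW.
have g0 := normr_ge0 g.
have mP : m \in @pbap R p.
  apply/asboolP; split.
    by move=> A B AB; rewrite /m content_setU_indic// dualD.
  by exists (`|g| + 1); [rewrite ltr_wpDl|apply: mb; rewrite lerDl].
exists (Pba mP) => //; apply/ler_addgt0Pr => e e0.
apply: ge_inf; first by exists 0 => C [/ltW].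
by split; [rewrite ltr_wpDl|apply: mb; rewrite lerDl ltW].
Qed.

Lemma pba_normP (mu : pba p) n (A : 'I_n -> content_set p) : trivIset setT A ->
  (\sum_(i < n) (`|mu (A i)|%:E / (omega (A i))%:E) <= `|mu|%:E)%E.
Proof.
move=> tA; apply/lee_addgt0Pr => e e0.
pose V := [set C | 0 < C /\ omega_bounded mu C].
have hi : has_inf V.
  split; last by exists 0 => C [/ltW].
  by have /asboolP[_ [C C0 uC]] := pba_funP mu; exists C.
have [C [C0 muC] Ce] := inf_adherent e0 hi.
by rewrite (le_trans (muC _ _ tA))// -EFinD lee_fin ltW.
Qed.

(** By the convention for division by 0, a nonzero value would make the bounded sum infinite. *)
Lemma pba_omega0 (mu : pba p) A : omega A = 0 -> mu A = 0.
Proof.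
move=> A0; have := @pba_normP mu 1 (fun=> A); rewrite big_ord1 A0 inver eqxx => h.
have {}h : (`|mu A|%:E * +oo <= `|mu|%:E)%E.
  by apply: h => i j _ _ _; rewrite (ord1 i) (ord1 j).
apply/eqP; rewrite -normr_eq0; move: h; have [//|mA] := eqVneq `|mu A| 0.
by rewrite gt0_muley ?lte_fin ?lt_neqAle 1?eq_sym ?mA//= leye_eq.
Qed.

(** * Integration against finitely additive set functions *)

Lemma pba_additive (mu : pba p) : finitely_additive mu.
Proof. by have /asboolP[] := pba_funP mu. Qed.

Lemma content_setI_proof A B : finite_content p (A `&` B).
Proof. exact: finite_content_sub (content_valP A). Qed.

Lemma content_setD_proof A B : finite_content p (A `\` B).
Proof. exact: finite_content_sub (content_valP A). Qed.

Let cI A B := ContentSet (content_setI_proof A B).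
Let cD A B := ContentSet (content_setD_proof A B).

Lemma additive_split mu A D : finitely_additive mu ->
  mu D = mu (cI D A) + mu (cD D A).
Proof.
move=> mua; rewrite -mua; last by apply/seteqP; split => // k /= [[_ kA] []].
by congr mu; apply: content_set_inj; rewrite /= setUIDK.
Qed.

(* Induction on the list of sets, splitting [D] along its head. *)
Lemma additive_sum0 mu (s : seq (R * content_set p)) D c : finitely_additive mu ->
  (forall k, content_val D k -> c + \sum_(a <- s) a.1 * \1_(a.2) k = 0) ->
  c * mu D + \sum_(a <- s) a.1 * mu (cI a.2 D) = 0.
Proof.
move=> mua; elim: s D c => [|a s IH] D c sD.
  rewrite big_nil addr0; have [[k Dk]|D0] := pselect (exists k, content_val D k).
    by have := sD k Dk; rewrite big_nil addr0 => ->; rewrite mul0r.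
  have DE : content_val D = set0.
    by apply/seteqP; split => // k Dk; apply: D0; exists k.
  (* The empty set is disjoint from itself, so additivity gives [mu D = mu D + mu D]. *)
  have := mua D D; rewrite {1}DE set0I (_ : content_setU D D = D); last first.
    by apply: content_set_inj; rewrite /= setUid.
  by move=> /(_ erefl) h; have -> : mu D = 0; [lra|rewrite mulr0].
(* [c] collects the coefficients of the sets already known to contain the piece: inside [a.2] it
   grows by [a.1], outside it is unchanged. *)
have h1 : (c + a.1) * mu (cI D a.2) + \sum_(b <- s) b.1 * mu (cI b.2 (cI D a.2)) = 0.
  apply: IH => k /= [Dk ak]; have := sD k Dk.
  by rewrite big_cons indicE mem_set//= mulr1 addrA.
have h2 : c * mu (cD D a.2) + \sum_(b <- s) b.1 * mu (cI b.2 (cD D a.2)) = 0.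
  apply: IH => k /= [Dk ak]; have := sD k Dk.
  by rewrite big_cons indicE memNset//= mulr0 add0r.
rewrite big_cons (additive_split a.2 D mua).
have -> : cI a.2 D = cI D a.2 by apply: content_set_inj; rewrite /= setIC.
have -> : \sum_(b <- s) b.1 * mu (cI b.2 D) =
    \sum_(b <- s) b.1 * mu (cI b.2 (cI D a.2)) + \sum_(b <- s) b.1 * mu (cI b.2 (cD D a.2)).
  rewrite -big_split; apply: eq_bigr => b _ /=; rewrite -mulrDr; congr (_ * _).
  rewrite (additive_split a.2 (cI b.2 D) mua); congr (mu _ + mu _);
    by apply: content_set_inj; rewrite /= ?setIA ?setIDA.
by move: h1 h2; lra.
Qed.

(** Lists permit overlapping and repeated sets, so addition is concatenation. *)
Definition indic_sum (s : seq (R * content_set p)) : ell p :=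
  \sum_(a <- s) a.1 *: ell_indic a.2.

Lemma indic_sumE s k : indic_sum s k = \sum_(a <- s) a.1 * \1_(a.2) k.
Proof. by rewrite /indic_sum (big_morph (fun x : ell p => x k) (id1 := 0) (op1 := +%R)). Qed.

(** [additive_sum0] with [c = 0] is applied to the formal difference of the lists, on a set
    containing every set that occurs. *)
Lemma additive_sum_eq mu s t : finitely_additive mu -> indic_sum s = indic_sum t ->
  \sum_(a <- s) a.1 * mu a.2 = \sum_(a <- t) a.1 * mu a.2.
Proof.
move=> mua st; pose s' := s ++ [seq (- a.1, a.2) | a <- t].
have [D0 D0P] : exists D0 : content_set p, forall D, content_val D0 `<=` content_val D ->
    \sum_(a <- s') a.1 * mu (cI a.2 D) = \sum_(a <- s') a.1 * mu a.2.
  elim: s' => [|a s' [D0 IH]].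
    by exists (ContentSet (finite_content_finite p (@finite_set0 nat))) => D _; rewrite !big_nil.
  exists (content_setU a.2 D0) => D; rewrite /= subUset => -[aD D0D].
  rewrite !big_cons IH//; congr (_ * mu _ + _).
  by apply: content_set_inj; apply/setIidPl.
have s'0 k : content_val D0 k -> 0 + \sum_(a <- s') a.1 * \1_(a.2) k = 0.
  move=> _; rewrite add0r big_cat big_map/= -indic_sumE st indic_sumE.
  rewrite -big_split/= big1// => a _.
  by rewrite mulNr subrr.
have := additive_sum0 mua s'0; rewrite mul0r add0r D0P// big_cat big_map/=.
under [X in _ + X]eq_bigr do rewrite mulNr.
by rewrite sumrN => /eqP; rewrite subr_eq0 => /eqP.
Qed.

Lemma simple_disjoint_sum : {in ell_simple p, forall x,
  exists n (c : 'I_n -> R) (A : 'I_n -> content_set p),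
  trivIset setT A /\ x = indic_sum [seq (c i, A i) | i <- enum 'I_n]}.
Proof.
move=> x /asboolP[n [c [A [tA ->]]]]; exists n, c, A; split => //.
by rewrite /indic_sum big_map big_enum.
Qed.

(** This is the integral against [mu], well defined by [additive_sum_eq]. In a disjoint
    representation each |c i| omega (A i) is at most the norm of [x], so the variation of [mu]
    relative to [omega] bounds the integral. *)
Lemma pba_functional (mu : pba p) : exists f : ell p -> R,
  [/\ linear_on (ell_simple p) f, {in ell_simple p, forall x, `|f x| <= `|mu| * `|x|} &
    forall A, f (ell_indic A) = mu A].
Proof.
have mua := pba_additive mu.
pose val (s : seq (R * content_set p)) := \sum_(a <- s) a.1 * mu a.2.
have fE x : exists r, forall s, x = indic_sum s -> r = val s.
  have [[s ->]|xs] := pselect (exists s, x = indic_sum s).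
    by exists (val s) => t; exact: additive_sum_eq.
  by exists 0 => s xE; case: xs; exists s.
have [f fP] := choice fE; exists f; split => [a x y xS yS|x xS|A].
- have [n [c [A [_ xE]]]] := simple_disjoint_sum xS.
  have [m [d [B [_ yE]]]] := simple_disjoint_sum yS.
  move: xE yE; set s := [seq _ | _ <- _]; set t := [seq _ | _ <- _] => xE yE.
  rewrite (fP _ _ xE) (fP _ _ yE) (fP _ ([seq (a * b.1, b.2) | b <- s] ++ t)).
    rewrite /val big_cat big_map/= mulr_sumr; congr (_ + _).
    by apply: eq_bigr => b _; rewrite mulrA.
  rewrite xE yE /indic_sum big_cat !big_map/= scaler_sumr; congr (_ + _).
  by apply: eq_bigr => i _; rewrite scalerA.
- have [n [c [A [tA xE]]]] := simple_disjoint_sum xS.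
  rewrite (fP _ _ xE) /val big_map big_enum/=.
  have r0 i : 0 <= `|mu (A i)| / omega (A i) by rewrite divr_ge0// normr_ge0.
  (* The germ norm is at most the norm of the indicator, and by disjointness [c i] times that
     indicator is dominated by [x]. *)
  have cx i : `|c i| * omega (A i) <= `|x|.
    rewrite (@le_trans _ _ (`|c i| * `|ell_indic (A i)|))//.
      by rewrite ler_wpM2l//; exact: quot_norm_le.
    rewrite -normrZ; apply: ell_norm_le => k.
    have -> : (c i *: ell_indic (A i)) k = c i * \1_(A i) k by [].
    rewrite indicE.
    have [ki|_] := boolP (k \in _); last by rewrite mulr0 normr0.
    rewrite mulr1 xE indic_sumE big_map big_enum/= (bigD1 i)//= big1 => [|j ji].
      by rewrite addr0 indicE ki mulr1.
    rewrite indicE memNset ?mulr0// => kj; move/eqP: ji; apply.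
    by apply: tA => //; exists k; split => //; exact: set_mem.
  have h : \sum_i `|mu (A i)| / omega (A i) <= `|mu|.
    rewrite -lee_fin (le_trans _ (pba_normP mu tA))// -sumEFin.
    apply: lee_sum => i _; rewrite inver; case: eqVneq => [A0|//].
    by rewrite (pba_omega0 mu A0) normr0 mul0r mul0e.
  rewrite (le_trans (ler_norm_sum _ _ _))// (le_trans _ (ler_wpM2r (normr_ge0 x) h))//.
  rewrite mulr_suml; apply: ler_sum => i _; rewrite normrM.
  have [A0|A0] := eqVneq (omega (A i)) 0.
    by rewrite (pba_omega0 mu A0) normr0 mul0r mulr0 mul0r.
  rewrite (le_trans _ (ler_wpM2l (r0 i) (cx i)))//.
  by rewrite [X in _ <= _ * X]mulrC mulrA divfK// mulrC.
- rewrite (fP _ [:: (1, A)]); first by rewrite /val big_seq1 mul1r.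
  by rewrite /indic_sum big_seq1 scale1r.
Qed.

End content_measures.

(** * The decomposition *)

Section isomorphism.
Context {R : realType} (p : finite_exponent R).

Local Notation Q := (quot_closure (ell_simple p)).
Local Notation pi := (\pi_Q : ell p -> Q).
Local Notation T := (ell (dual_exponent p) * pba p * dual Q)%type.

Let fin_regular_eq0 (g : dual (ell p)) : regular (@finite_set nat) g ->
  (forall k, g (ell_delta p k) = 0) -> g = 0.
Proof.
move=> rg g0; apply: (@regular_eq0 _ _ _ (finsupp p : submodClosed _) _ finite_set_ideal) => //.
  by move=> x A fA; apply: mem_closurep; exact: ell_res_finsupp.
exact: dual_finsupp0.
Qed.

Let dual_simple0 (g : dual (ell p)) : (forall A, g (ell_indic A) = 0) ->
  {in ell_simple p, forall x, g x = 0}.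
Proof.
move=> g0 x /asboolP[n [c [A [_ ->]]]]; rewrite dual_sum big1// => i _.
by rewrite dualZ g0 mulr0.
Qed.

Let content_regular_eq0 (g : dual (ell p)) : regular (finite_content p) g ->
  (forall A, g (ell_indic A) = 0) -> g = 0.
Proof.
move=> rg g0;
apply: (@regular_eq0 _ _ _ (ell_simple p : submodClosed _) _
  (finite_content_ideal p)) => //.
  by move=> x A cA; exact: ell_res_simple.
exact: dual_simple0.
Qed.

Let fin_extension (f : ell p -> R) C : 0 <= C -> linear_on (finsupp p) f ->
  {in finsupp p, forall x, `|f x| <= C * `|x|} ->
  exists g : dual (ell p), [/\ regular (@finite_set nat) g,
    {in finsupp p, g =1 f} & `|g| <= C].
Proof.
apply: (@regular_extension _ _ _ (finsupp p : submodClosed _) _ _ finite_set_ideal).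
  by move=> x A fA; apply: mem_closurep; exact: ell_res_finsupp.
exact: finsupp_ell_res.
Qed.

Let content_extension (f : ell p -> R) C : 0 <= C -> linear_on (ell_simple p) f ->
  {in ell_simple p, forall x, `|f x| <= C * `|x|} ->
  exists g : dual (ell p), [/\ regular (finite_content p) g,
    {in ell_simple p, g =1 f} & `|g| <= C].
Proof.
apply: (@regular_extension _ _ _ (ell_simple p : submodClosed _) _ _ (finite_content_ideal p)).
  by move=> x A cA; exact: ell_res_simple.
exact: ell_simple_ell_res.
Qed.

Let pi_simple x : x \in ell_simple p -> pi x = 0.
Proof.
move=> xS; have pi0 : pi 0 = 0.
  by apply: (addrI (pi 0)); rewrite -quot_piD !addr0.
by rewrite -pi0; apply/quot_piP; rewrite subr0; exact: mem_closurep.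
Qed.

Let dual_pi (h : dual Q) : exists2 d : dual (ell p),
  (forall x, d x = h (pi x)) & `|d| <= `|h|.
Proof.
have dl : linear (fun x => h (pi x)).
  by move=> a x y; rewrite quot_piD -quot_pi_scale; exact: dual_lin.
have dC x : `|h (pi x)| <= `|h| * `|x|.
  by rewrite (le_trans (dual_ub _ _))// ler_wpM2l//; exact: quot_norm_le.
have [d dE] := dual_of dl dC; exists d; first exact: dE.
by apply: dual_norm_le_ub => // x; rewrite dE.
Qed.

Let ell_delta_ellb k : ell_delta p k \in ellb p.
Proof.
apply/asboolP; exists (p k) => j; rewrite ell_deltaE.
by have [->//|] := eqVneq j k; rewrite eqxx.
Qed.

(** Unit vectors lie in [ellb]; hence every member of [pba] vanishes on singletons. *)
Let omega_delta k : omega (delta_set p k) = 0.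
Proof.
have pi0 : \pi_(ell_germ p) (0 : ell p) = 0.
  by apply: (addrI (\pi_(ell_germ p) (0 : ell p))); rewrite -quot_piD !addr0.
rewrite /omega (_ : \pi _ = 0) ?normr0// -[RHS]pi0.
by apply/quot_piP; rewrite subr0; apply: mem_closurep; exact: ell_delta_ellb.
Qed.

(** A relation, in the shape that [isomorphic_rel] takes; [g1] and [g2] are the regular functionals
    determined by the first two components of [t]. *)
Definition decomposition (f : dual (ell p)) (t : T) :=
  exists g1 g2 : dual (ell p),
  [/\ regular (@finite_set nat) g1, (forall k, g1 (ell_delta p k) = t.1.1 k),
      regular (finite_content p) g2, (forall A, g2 (ell_indic A) = t.1.2 A) &
      forall x, f x = g1 x + g2 x + t.2 (pi x)].

Lemma decomposition_comb a f g t u : decomposition f t -> decomposition g u ->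
  decomposition (a *: f + g) (a *: t + u).
Proof.
move=> [f1 [f2 [rf1 f1E rf2 f2E fE]]] [g1 [g2 [rg1 g1E rg2 g2E gE]]].
exists (a *: f1 + g1), (a *: f2 + g2); split.
- by apply: regular_comb => //; exact: finite_set_ideal.
- by move=> k; rewrite dual_comb f1E g1E.
- by apply: regular_comb => //; exact: finite_content_ideal.
- by move=> A; rewrite dual_comb f2E g2E.
- move=> x; rewrite dual_comb fE gE [RHS](_ : _ = (a * f1 x + g1 x) +
    (a * f2 x + g2 x) + (a * t.2 (pi x) + u.2 (pi x)))//.
  by lra.
Qed.

(** [g1] extends [f] from finite supports and [g2] extends [f - g1] from simple elements, so the
    remainder kills simple elements and descends to the quotient. *)
Lemma decomposition_exists (f : dual (ell p)) :
  exists2 t, decomposition f t & `|t| <= 4 * `|f|.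
Proof.
have f0 := normr_ge0 f.
have [g1 [rg1 g1f g1n]] : exists g : dual (ell p), [/\ regular (@finite_set nat) g,
    {in finsupp p, g =1 f} & `|g| <= `|f|].
  apply: fin_extension => //; first by move=> a x y _ _; exact: dual_lin.
  by move=> x _; exact: dual_ub.
have fg1 : `|f - g1| <= 2 * `|f| by rewrite (le_trans (ler_normB _ _))//; lra.
have [g2 [rg2 g2f g2n]] : exists g : dual (ell p), [/\ regular (finite_content p) g,
    {in ell_simple p, g =1 (f - g1 : dual (ell p))} & `|g| <= `|f - g1|].
  apply: content_extension => //; first by move=> a x y _ _; exact: dual_lin.
  by move=> x _; exact: dual_ub.
have [y yE yn] := dual_delta_ell g1.
(* [f] and [g1] agree on unit vectors, so [g2] kills them and with them [ellb], as [dual_pba]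
   demands. *)
have g2d k : g2 (ell_delta p k) = 0.
  rewrite g2f ?ell_simple_indic// [LHS](_ : _ = f (ell_delta p k) - g1 (ell_delta p k))//.
  by rewrite g1f ?subrr// ell_delta_finsupp.
have [x xb|mu muE mun] := @dual_pba _ _ g2.
  by apply: (dual_ellb0 g2d); exact: mem_closurep.
have [x xS|h hE hn] := @dual_quot _ _ (ell_simple p : submodClosed _) (f - g1 - g2).
  by rewrite [LHS](_ : _ = (f - g1 : dual _) x - g2 x)// g2f// subrr.
exists (y, mu, h); first exists g1, g2.
  split => //= x; rewrite hE [X in _ = _ + X](_ : _ = f x - g1 x - g2 x)//; lra.
(* Both [f - g1] and [g2] have norm at most 2 |f|; the product carries the maximum norm. *)
have fgg : `|f - g1 - g2| <= 4 * `|f| by rewrite (le_trans (ler_normB _ _))//; lra.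
by rewrite !prod_normE/= !ge_max; apply/andP; split; [apply/andP; split|]; lra.
Qed.

(** [g1] extends the pairing with [y] from finite supports, [g2] the integral against [mu] from
    simple elements. The 4 is 2 from Hoelder's inequality and 1 for each other summand. *)
Lemma decomposition_sum (t : T) : exists2 f, decomposition f t & `|f| <= 4 * `|t|.
Proof.
case: t => [[y mu] h].
have tE : [/\ `|y| <= `|(y, mu, h)|, `|mu| <= `|(y, mu, h)| & `|h| <= `|(y, mu, h)|].
  by rewrite !prod_normE/= !le_max !lexx !orbT.
have C0 : 0 <= 2 * `|y| by rewrite mulr_ge0.
pose s (x : ell p) n := \sum_(k < n) x k * y k.
have s_ub (x : ell p) n m : (n <= m)%N ->
    (forall k, (n <= k)%N -> x k = 0) -> s x m = s x n.
  move=> nm xn; rewrite /s (big_ord_widen m (fun k => x k * y k) nm) [RHS]big_mkcond.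
  by apply: eq_bigr => k _; case: ltnP => // /xn ->; rewrite mul0r.
(* The pairing does not depend on the cut-off beyond the support; off [finsupp] it defaults to 0. *)
have fE (x : ell p) : exists r, forall n,
    (forall k, (n <= k)%N -> x k = 0) -> r = s x n.
  have [[n xn]|xoo] := pselect (exists n, forall k, (n <= k)%N -> x k = 0); last first.
    by exists 0 => n xn; case: xoo; exists n.
  exists (s x n) => m xm.
  by rewrite -(s_ub x n (maxn n m))// ?leq_maxl// (s_ub x m)// leq_maxr.
have [f fP] := choice fE.
have [g1 [rg1 g1f g1n]] : exists g : dual (ell p), [/\ regular (@finite_set nat) g,
    {in finsupp p, g =1 f} & `|g| <= 2 * `|y|].
  apply: fin_extension => //.
    move=> a x z /asboolP[n xn] /asboolP[m zm].
    have xN k : (maxn n m <= k)%N -> x k = 0 by rewrite geq_max => /andP[/xn].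
    have zN k : (maxn n m <= k)%N -> z k = 0 by rewrite geq_max => /andP[_ /zm].
    rewrite (fP _ _ xN) (fP _ _ zN) (fP _ (maxn n m)) => [|k kN]; last first.
      by rewrite ell_linearE xN// zN// mulr0 addr0.
    rewrite /s mulr_sumr -big_split; apply: eq_bigr => k _ /=.
    by rewrite [X in X * _](_ : _ = a * x k + z k)// mulrDl mulrA.
  move=> x /asboolP[n xn]; rewrite (fP _ _ xn) (le_trans (ler_norm_sum _ _ _))//.
  by rewrite (le_trans (hoelder_ell _ _ _))// mulrAC.
have g1E k : g1 (ell_delta p k) = y k.
  rewrite g1f ?ell_delta_finsupp// (fP _ k.+1) => [|j kj]; last by rewrite ell_deltaE gtn_eqF.
  rewrite /s (eq_bigr (fun j : 'I_k.+1 => (j == k :> nat)%:R * y j)) => [|j _]; last first.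
    by rewrite ell_deltaE.
  by rewrite big_ord_recr/= eqxx mul1r big1 ?add0r// => j _; rewrite ltn_eqF ?mul0r.
have [e [elin eC eE]] := pba_functional mu.
have [g2 [rg2 g2e g2n]] := content_extension (normr_ge0 mu) elin eC.
have g2E A : g2 (ell_indic A) = mu A by rewrite g2e ?eE// ell_simple_indic.
have [d dE dn] := dual_pi h.
exists (g1 + g2 + d); first exists g1, g2.
  by split => // x; rewrite -dE.
case: tE => ty tm th.
have := ler_normD (g1 + g2) d; have := ler_normD g1 g2; lra.
Qed.

(** At unit vectors only [g1] can contribute, so [f] determines its values there. *)
Let delta_eq0 (g2 : dual (ell p)) (h : dual Q) (mu : pba p) :
  (forall A, g2 (ell_indic A) = mu A) ->
  forall k, g2 (ell_delta p k) + h (pi (ell_delta p k)) = 0.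
Proof.
by move=> g2E k; rewrite g2E pi_simple ?ell_simple_indic// dual0 addr0 pba_omega0// omega_delta.
Qed.

(** The components are peeled off in order: unit vectors give [g1 = 0], then indicators give
    [g2 = 0], and what remains is [h]. *)
Lemma decomposition0l t : decomposition 0 t -> t = 0.
Proof.
move: t => [[y mu] h] [g1 [g2 [rg1 /= g1E rg2 g2E fE]]].
have g1k k : g1 (ell_delta p k) = 0.
  have := fE (ell_delta p k).
  rewrite -addrA (delta_eq0 h g2E) addr0 => <-.
  by [].
have g10 := fin_regular_eq0 rg1 g1k.
have g2A A : g2 (ell_indic A) = 0.
  have := fE (ell_indic A).
  by rewrite g10 pi_simple ?ell_simple_indic// dual0 addr0 [X in X + _](_ : _ = 0)// add0r => <-.
have g20 := content_regular_eq0 rg2 g2A.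
congr (_, _, _).
- by apply: ell_ext => k; rewrite -g1E g1k.
- by apply/val_inj/funext => A; rewrite /= -g2E g2A.
- apply/val_inj/funext => v; suff hv : h v = 0 by exact: hv.
  have := fE (repr v); rewrite g10 g20 reprK => hv.
  by rewrite -[h v]add0r -[0 + h v]add0r addrA -[LHS]hv.
Qed.

Lemma decomposition0r f : decomposition f 0 -> f = 0.
Proof.
move=> [g1 [g2 [rg1 g1E rg2 g2E fE]]].
have g10 := fin_regular_eq0 rg1 g1E.
have g20 := content_regular_eq0 rg2 g2E.
apply/val_inj/funext => x; rewrite [LHS]fE g10 g20.
by rewrite [LHS](_ : _ = 0 + 0 + 0)// !addr0.
Qed.

End isomorphism.

Theorem theorem3p23 (R : realType) (p : finite_exponent R) :
  isomorphic (dual (ell p))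
    (ell (dual_exponent p) * pba p * dual (quot_closure (ell_simple p)))%type.
Proof.
apply: (@isomorphic_rel _ _ _ (@decomposition R p)).
- by move=> a f g t u; exact: decomposition_comb.
- exact: decomposition_exists.
- exact: decomposition_sum.
- exact: decomposition0l.
- exact: decomposition0r.
Qed.
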